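(* Consider the setting described in the context. For $F\in V^*$ let $u\in V$ be the solution to $a(u,v)=F(v)$ for all $v\in V$, and let $u_{\mathrm{nc}}\in V_{\mathrm{nc}}$ be the solution to the modified scheme $a_{\mathrm{pw}}(u_{\mathrm{nc}},v_{\mathrm{nc}})=F(Jv_{\mathrm{nc}})$ for all $v_{\mathrm{nc}}\in V_{\mathrm{nc}}$. (a) For every $F\in V^*$, $$|\!|\!| u-u_{\mathrm{nc}}|\!|\!|_{\mathrm{pw}}\le\sqrt{1+\Lambda_0^2}\;|\!|\!| u-I_{\mathrm{nc}}u|\!|\!|_{\mathrm{pw}}.$$ (b) The constant $C_{\mathrm{qo}}:=\sqrt{1+\Lambda_0^2}$ is attained: there exist $u\in V$ and $F=a(u,\cdot)\in V^*$ such that the corresponding $u_{\mathrm{nc}}$ satisfies $$|\!|\!| u-u_{\mathrm{nc}}|\!|\!|_{\mathrm{pw}}=C_{\mathrm{qo}}\,|\!|\!| u-I_{\mathrm{nc}}u|\!|\!|_{\mathrm{pw}}>0.$$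
   Context: Let $m\in\mathbb N$, let $\Omega\subset\mathbb R^2$ be a planar bounded Lipschitz domain with polygonal boundary, $V:=H^m_0(\Omega)$, $V^*=H^{-m}(\Omega)$, and $a(v,w):=\int_\Omega D^m v:D^m w\,dx$ for $v,w\in V$. Write $\|\cdot\|:=\|\cdot\|_{L^2(\Omega)}$. Let $\mathcal T$ be a shape-regular triangulation of $\Omega$ into triangles, $P_k(\mathcal T)$ the space of piecewise polynomials of total degree at most $k$, $H^m(\mathcal T):=\{v\in L^2(\Omega): v|_T\in H^m(T)\ \forall T\in\mathcal T\}$, and $h_{\mathcal T}\in P_0(\mathcal T)$ with $h_{\mathcal T}|_T=\mathrm{diam}(T)$. Set $a_{\mathrm{pw}}(v,w):=\sum_{T\in\mathcal T}\int_T D^m v:D^m w\,dx$ for $v,w\in H^m(\mathcal T)$ and $|\!|\!| v|\!|\!|_{\mathrm{pw}}:=a_{\mathrm{pw}}(v,v)^{1/2}$. $V_{\mathrm{nc}}\subset P_m(\mathcal T)$ is a linear subspace, $V_{\mathrm{nc}}\neq\{0\}$, on which $|\!|\!|\cdot|\!|\!|_{\mathrm{pw}}$ is a norm. There are an interpolation operator $I_{\mathrm{nc}}:V\to V_{\mathrm{nc}}$ and a constant $\kappa_m>0$ with, for all $v\in V$ and $w_m\in P_m(\mathcal T)$, $$a_{\mathrm{pw}}(v-I_{\mathrm{nc}}v,w_m)=0,\qquad \|h_{\mathcal T}^{-m}(v-I_{\mathrm{nc}}v)\|\le\kappa_m|\!|\!| v-I_{\mathrm{nc}}v|\!|\!|_{\mathrm{pw}}.$$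 There are a linear operator $J:V_{\mathrm{nc}}\to V$ and a constant $\Lambda_{\mathrm J}$ such that for all $v_{\mathrm{nc}}\in V_{\mathrm{nc}}$ and $v\in V$: $I_{\mathrm{nc}}Jv_{\mathrm{nc}}=v_{\mathrm{nc}}$ and $|\!|\!| v_{\mathrm{nc}}-Jv_{\mathrm{nc}}|\!|\!|_{\mathrm{pw}}\le\Lambda_{\mathrm J}|\!|\!| v_{\mathrm{nc}}-v|\!|\!|_{\mathrm{pw}}$. Definition: $\Lambda_0:=\sup_{v_{\mathrm{nc}}\in V_{\mathrm{nc}}\setminus\{0\}}|\!|\!| v_{\mathrm{nc}}-Jv_{\mathrm{nc}}|\!|\!|_{\mathrm{pw}}/|\!|\!| v_{\mathrm{nc}}|\!|\!|_{\mathrm{pw}}$ (and $\Lambda_0\le\Lambda_{\mathrm J}$). *)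

(* Defs.v *)
From HB Require Import structures.
From mathcomp Require Import all_boot all_order all_algebra.
From mathcomp Require Import all_classical all_reals all_analysis.
Set Implicit Arguments.
Unset Strict Implicit.
Unset Printing Implicit Defensive.
Import Order.TTheory GRing.Theory Num.Theory.
Import numFieldNormedType.Exports.
Local Open Scope classical_set_scope.
Local Open Scope ring_scope.

(* The elements of L^2(D), H^m(D), P_k(T), V_nc, ... are represented by
   functions R * R -> R of which only the values on D matter: two functions
   that agree a.e. on D represent the same element.  Equality of elements is
   therefore always "= %[ae leb2 in D]", and each of these spaces is a set of
   functions closed under replacing a member by another representative. *)

Section Plane.
Context {R : realType}.
Implicit Types (D : set (R * R)) (p q x : R * R).

Definition leb2 :
    {measure set (measurableTypeR R * measurableTypeR R)%type -> \bar R} :=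
  (lebesgue_measure \x lebesgue_measure)%E.

(* The norm of the library on R * R is the maximum norm. *)
Definition edist p q : R :=
  Num.sqrt ((p.1 - q.1) ^+ 2 + (p.2 - q.2) ^+ 2).

Definition diam D : R := sup [set edist x.1 x.2 | x in D `*` D].

Definition bdry D : set (R * R) := closure D `\` D°.

(* Near each boundary point, D is the part strictly above the graph of a
   Lipschitz function in coordinates rotated by (c, s) = (cos t, sin t). *)
Definition lipschitz_boundary D : Prop :=
  forall p, bdry D p ->
  exists (c s r L : R) (gamma : R -> R),
    [/\ c ^+ 2 + s ^+ 2 = 1, 0 < r, L.-lipschitz gamma &
        forall x, edist p x < r ->
          (D x <-> gamma (c * x.1 + s * x.2) < - s * x.1 + c * x.2)].

Definition polygonal_boundary D : Prop :=
  exists e : seq ((R * R) * (R * R)),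
    bdry D = [set x | exists2 ab, ab \in e &
      exists2 t : R, 0 <= t <= 1 & x = (1 - t) *: ab.1 + t *: ab.2].

Definition polygonal_lipschitz_domain D : Prop :=
  [/\ open D, connected D & D !=set0] /\
  [/\ bounded_set D, lipschitz_boundary D & polygonal_boundary D].

End Plane.

Section Sobolev.
Context {R : realType}.
Implicit Types (U : set (R * R)) (f g v w phi : R * R -> R) (s : seq 'I_2).

Definition L2 U f : Prop := (f \_ U) \in Lfun leb2 2%:E.

Definition L2norm U f : R := Num.sqrt (\int[leb2]_(x in U) (f x ^+ 2)).

Definition unit_vec (i : 'I_2) : R * R := ((i == 0)%:R, (i == 1)%:R).

(* partials [:: i1; ...; ik] f = d/dx_i1 (... (d/dx_ik f)) *)
Definition partials s f : R * R -> R :=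
  foldr (fun i g => 'D_(unit_vec i) g) f s.

Definition smooth f : Prop := forall s, continuous (partials s f) /\
  forall i x, derivable (partials s f) x (unit_vec i).

(* C_c^oo(U), the functions being extended by zero to the plane *)
Definition test_function U phi : Prop :=
  [/\ smooth phi, compact (closure [set x | phi x != 0]) &
      closure [set x | phi x != 0] `<=` U].

Definition is_weak_partial U s f g : Prop :=
  forall phi, test_function U phi ->
    \int[leb2]_(x in U) (f x * partials s phi x) =
    (- 1) ^+ size s * \int[leb2]_(x in U) (g x * phi x).

(* A representative of the (a.e. unique) weak partial derivative in L^2(U) *)
Definition weak_partial U s f : R * R -> R :=
  xget (cst 0) [set g | L2 U g /\ is_weak_partial U s f g].

Definition Hm U m : set (R * R -> R) :=
  [set f | L2 U f /\ forall s, (size s <= m)%N ->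
     exists2 g, L2 U g & is_weak_partial U s f g].

(* int_U D^k v : D^k w, where D^k v is the tensor with the 2^k entries
   d^k v / dx_i1 ... dx_ik *)
Definition dotD U k v w : R :=
  \int[leb2]_(x in U)
    (\sum_(s : k.-tuple 'I_2) weak_partial U s v x * weak_partial U s w x).

Definition Hm_norm U m v : R := Num.sqrt (\sum_(k < m.+1) dotD U k v v).

(* H^m_0(U), the closure of C_c^oo(U) in H^m(U) *)
Definition H0m U m : set (R * R -> R) :=
  [set v | Hm U m v /\ forall eps : R, 0 < eps ->
     exists2 phi, test_function U phi & Hm_norm U m (v \- phi) < eps].

(* F is a bounded linear functional on H^m_0(U); only its values there matter *)
Definition H0m_dual U m (F : (R * R -> R) -> R) : Prop :=
  (forall (a : R) v w, H0m U m v -> H0m U m w ->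
     F (fun x => a * v x + w x) = a * F v + F w) /\
  exists C : R, forall v, H0m U m v -> `|F v| <= C * Hm_norm U m v.

End Sobolev.

Section Triangulation.
Context {R : realType}.

(* The convex hull of the vertices t k with k in S *)
Definition face (t : 'I_3 -> R * R) (S : {set 'I_3}) : set (R * R) :=
  [set x | exists l : 'I_3 -> R,
     [/\ forall k, 0 <= l k, forall k, k \notin S -> l k = 0,
         \sum_k l k = 1 & x = \sum_k l k *: t k]].

Definition triangle (t : 'I_3 -> R * R) : set (R * R) := face t [set: 'I_3]%SET.

Definition nondegenerate (t : 'I_3 -> R * R) : Prop :=
  let p := t (inord 1) - t (inord 0) in let q := t (inord 2) - t (inord 0) in
  p.1 * q.2 - p.2 * q.1 != 0.

Definition common_vertices (t t' : 'I_3 -> R * R) : {set 'I_3} :=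
  [set k | [exists l, t k == t' l]]%SET.

Implicit Types (N : nat) (Omega : set (R * R)) (v w : R * R -> R).

(* Distinct triangles meet in the empty set, a common vertex or a common edge,
   according to the number (at most 2) of common vertices. *)
Definition triangulation Omega N (T : 'I_N -> 'I_3 -> R * R) : Prop :=
  [/\ forall i, nondegenerate (T i),
      closure Omega = \bigcup_i triangle (T i) &
      forall i j, i != j ->
        common_vertices (T i) (T j) != [set: 'I_3]%SET /\
        triangle (T i) `&` triangle (T j) =
          face (T i) (common_vertices (T i) (T j))].

(* Each triangle contains a disc of radius at least diam / sigma. *)
Definition shape_regular (sigma : R) N (T : 'I_N -> 'I_3 -> R * R) : Prop :=
  forall i, exists (c : R * R) (rho : R),
    [/\ 0 < rho, diam (triangle (T i)) <= sigma * rho &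
        [set x | edist c x <= rho] `<=` triangle (T i)].

(* The value on the skeleton, a null set, is irrelevant. *)
Definition meshsize N (T : 'I_N -> 'I_3 -> R * R) (x : R * R) : R :=
  \sum_i diam (triangle (T i)) * \1_((triangle (T i))°) x.

Definition polynomial_le k (p : R * R -> R) : Prop :=
  exists c : nat -> nat -> R, forall x,
    p x = \sum_(i < k.+1) \sum_(j < k.+1 | (i + j <= k)%N)
            c i j * x.1 ^+ i * x.2 ^+ j.

Definition Pk Omega N (T : 'I_N -> 'I_3 -> R * R) k : set (R * R -> R) :=
  [set v | L2 Omega v /\ forall i, exists2 p, polynomial_le k p &
     v = p %[ae leb2 in (triangle (T i))°]].

Definition apw N (T : 'I_N -> 'I_3 -> R * R) m v w : R :=
  \sum_i dotD (triangle (T i))° m v w.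

Definition normpw N (T : 'I_N -> 'I_3 -> R * R) m v : R :=
  Num.sqrt (apw T m v v).

End Triangulation.

Section Spaces.
Context {R : realType}.
Implicit Types (Omega : set (R * R)) (A B : set (R * R -> R))
  (L : (R * R -> R) -> R * R -> R) (v w : R * R -> R).

Definition linear_subspace Omega A : Prop :=
  [/\ A (cst 0),
      forall (a : R) v w, A v -> A w -> A (fun x => a * v x + w x) &
      forall v w, A v -> L2 Omega w -> v = w %[ae leb2 in Omega] -> A w].

Definition is_norm Omega A (nu : (R * R -> R) -> R) : Prop :=
  [/\ forall v, A v -> 0 <= nu v,
      forall v, A v -> nu v = 0 -> v = cst 0 %[ae leb2 in Omega],
      forall (a : R) v, A v -> nu (fun x => a * v x) = `|a| * nu v &
      forall v w, A v -> A w -> nu (v \+ w) <= nu v + nu w].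

(* L maps the elements represented in A to elements represented in B. *)
Definition operator Omega A B L : Prop :=
  (forall v, A v -> B (L v)) /\
  (forall v w, A v -> A w -> v = w %[ae leb2 in Omega] ->
     L v = L w %[ae leb2 in Omega]).

Definition linear_operator Omega A B L : Prop :=
  operator Omega A B L /\
  forall (a : R) v w, A v -> A w ->
    L (fun x => a * v x + w x) = (fun x => a * L v x + L w x)
      %[ae leb2 in Omega].

End Spaces.

Section Scheme.
Context {R : realType}.
Variables (m : nat) (Omega : set (R * R)) (N : nat).
Variables (T : 'I_N -> 'I_3 -> R * R).
Implicit Types (Vnc : set (R * R -> R)) (I J : (R * R -> R) -> R * R -> R)
  (F : (R * R -> R) -> R) (u v w : R * R -> R).

Definition nc_space Vnc : Prop :=
  [/\ Vnc `<=` Pk Omega T m, linear_subspace Omega Vnc,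
      exists2 v, Vnc v & ~ v = cst 0 %[ae leb2 in Omega] &
      is_norm Omega Vnc (normpw T m)].

Definition interpolation Vnc I (kappa : R) : Prop :=
  [/\ operator Omega (H0m Omega m) Vnc I,
      forall v w, H0m Omega m v -> Pk Omega T m w -> apw T m (v \- I v) w = 0 &
      forall v, H0m Omega m v ->
        L2norm Omega (fun x => meshsize T x ^- m * (v x - I v x)) <=
          kappa * normpw T m (v \- I v)].

Definition companion Vnc I J (LambdaJ : R) : Prop :=
  [/\ linear_operator Omega Vnc (H0m Omega m) J,
      forall v, Vnc v -> I (J v) = v %[ae leb2 in Omega] &
      forall vnc v, Vnc vnc -> H0m Omega m v ->
        normpw T m (vnc \- J vnc) <= LambdaJ * normpw T m (vnc \- v)].

Definition Lambda0 Vnc J : R :=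
  sup [set normpw T m (v \- J v) / normpw T m v |
        v in [set v | Vnc v /\ ~ v = cst 0 %[ae leb2 in Omega]]].

Definition solution F u : Prop :=
  H0m Omega m u /\ forall v, H0m Omega m v -> dotD Omega m u v = F v.

Definition nc_solution Vnc J F unc : Prop :=
  Vnc unc /\ forall vnc, Vnc vnc -> apw T m unc vnc = F (J vnc).

End Scheme.

(* Main.v *)
Require Import Defs.
From mathcomp Require Import all_boot all_order all_algebra.
From mathcomp Require Import ring lra.
From mathcomp Require Import all_classical all_reals all_analysis.
From mathcomp Require Import measurable_realfun.
Import Order.TTheory GRing.Theory Num.Theory.
Import numFieldNormedType.Exports.
Local Open Scope classical_set_scope.
Local Open Scope ring_scope.

(** The energy error splits by Pythagoras: the interpolation error [u - I u] is
    orthogonal to the piecewise polynomials of degree [m], and the rest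
    [d = I u - unc] lies in the discrete space. Testing the scheme with [d], and
    using that [d - J d] is orthogonal to the piecewise polynomials as well,
    since [I (J d) = d], gives [apw d d = apw (u - I u) (d - J d)]. By
    Cauchy-Schwarz and the definition of [Lambda0] the seminorm of [d] is at most
    [Lambda0] times that of [u - I u], which is the upper bound
    ([quasi_optimal]).

    For sharpness, the quotient defining [Lambda0] attains its maximum at some
    [e], as the discrete space is finite-dimensional ([form_maximiser]). A
    maximiser is an eigenvector: [apw (e - J e) (v - J v) = Lambda0 ^+ 2 * apw e v].
    With [u = J e] the interpolation error is [J e - e] and the discrete solution
    is [(1 + Lambda0 ^+ 2) *: e], so the two parts of the error are in the ratio
    [1 : Lambda0] ([quasi_optimal_sharp]). If [Lambda0 = 0] this choice has no
    error at all, but the scheme returns [I u] and any conforming [u] whose [m]-th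
    derivatives are not piecewise constant will do ([conforming_not_polynomial]).

    These arguments take place in a vector space with a semidefinite form. To apply
    them, the piecewise energy product has to be bilinear and to agree with the
    energy product of the domain on conforming functions. Both rest on the
    uniqueness of weak derivatives, that is on the fundamental lemma of the calculus
    of variations ([fundamental_lemma]): products of functions [exp(-1/t)] give test
    functions that tend to the indicator of a rectangle, and a Dynkin system
    argument passes from rectangles to measurable sets. Existence of weak
    derivatives of test functions and of polynomials is integration by parts
    ([smooth_weak_partial]). The agreement of the two products ([dotD_apw]) also
    needs that the open triangles lie in the domain, where the Lipschitz boundary
    enters ([lipschitz_closure_interior]), and that they cover it disjointly up to
    a null set ([cells_partition_ae]). *)

(** * Semidefinite forms on subspaces *)

Section Forms.
Context {R : realType} {E : lmodType R}.
Implicit Types (W A V : set E) (b g : E -> E -> R).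

(** Spaces of functions known up to null sets carry forms that make sense only on
    a part of the type of all functions, so linearity and positivity are relative
    to a set. *)
Definition subspace W : Prop :=
  W 0 /\ forall (a : R) v w, W v -> W w -> W (a *: v + w).

Definition psd_form W b : Prop :=
  [/\ forall v w, W v -> W w -> b v w = b w v,
      forall (a : R) u v w, W u -> W v -> W w ->
        b (a *: u + v) w = a * b u w + b v w &
      forall v, W v -> 0 <= b v v].

Section Subspace.
Context {W : set E} (hW : subspace W).

Lemma subspace0 : W 0. Proof. by case: hW. Qed.

Lemma subspaceZ a v : W v -> W (a *: v).
Proof. by case: hW => h0 h Wv; rewrite -[_ *: _]addr0; apply: h. Qed.

Lemma subspaceD v w : W v -> W w -> W (v + w).
Proof. by case: hW => h0 h Wv Ww; rewrite -[v]scale1r; apply: h. Qed.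

Lemma subspaceB v w : W v -> W w -> W (v - w).
Proof. by move=> Wv Ww; rewrite -scaleN1r addrC; case: hW => _; apply. Qed.

Lemma subspace_sum n (x : 'I_n -> R) (e : 'I_n -> E) :
  (forall i, W (e i)) -> W (\sum_i x i *: e i).
Proof.
move=> We; elim/big_ind: _ => //; first exact: subspace0.
  by move=> v w; exact: subspaceD.
by move=> i _; exact: subspaceZ.
Qed.

End Subspace.

Section Form.
Context {W : set E} (hW : subspace W) {b : E -> E -> R}
  (hb : psd_form W b).

Lemma formC {v w} : W v -> W w -> b v w = b w v.
Proof. by case: hb => h _ _; apply: h. Qed.

Lemma form_ge0 {v} : W v -> 0 <= b v v.
Proof. by case: hb => _ _; apply. Qed.

Lemma formZDl a {u v w} : W u -> W v -> W w ->
  b (a *: u + v) w = a * b u w + b v w.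
Proof. by case: hb => _ h _; apply: h. Qed.

Lemma formDl {u v w} : W u -> W v -> W w -> b (u + v) w = b u w + b v w.
Proof. by move=> *; rewrite -[u]scale1r formZDl// scale1r mul1r. Qed.

Lemma form0l {w} : W w -> b 0 w = 0.
Proof.
move=> Ww; have W0 := subspace0 hW; have := formDl W0 W0 Ww; rewrite addr0.
by move=> h; lra.
Qed.

Lemma formZl a {u w} : W u -> W w -> b (a *: u) w = a * b u w.
Proof.
by move=> Wu Ww; rewrite -[a *: u]addr0 formZDl ?form0l ?addr0//; exact: subspace0.
Qed.

Lemma formBl {u v w} : W u -> W v -> W w -> b (u - v) w = b u w - b v w.
Proof.
by move=> Wu Wv Ww; rewrite -scaleN1r addrC formZDl// mulN1r addrC.
Qed.

Lemma formDr {u v w} : W u -> W v -> W w -> b u (v + w) = b u v + b u w.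
Proof.
move=> Wu Wv Ww; rewrite formC//; last exact: subspaceD.
by rewrite formDl// (formC Wv)// (formC Ww).
Qed.

Lemma formZr a {u v} : W u -> W v -> b u (a *: v) = a * b u v.
Proof.
move=> Wu Wv; rewrite formC//; last exact: subspaceZ.
by rewrite formZl// (formC Wv).
Qed.

Lemma formBr {u v w} : W u -> W v -> W w -> b u (v - w) = b u v - b u w.
Proof.
move=> Wu Wv Ww; rewrite formC//; last exact: subspaceB.
by rewrite formBl// (formC Wv)// (formC Ww).
Qed.

Lemma form_suml n (x : 'I_n -> R) (e : 'I_n -> E) w :
  (forall i, W (e i)) -> W w ->
  b (\sum_i x i *: e i) w = \sum_i x i * b (e i) w.
Proof.
move=> We Ww.
have [//] : W (\sum_i x i *: e i) /\
  b (\sum_i x i *: e i) w = \sum_i x i * b (e i) w.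
apply: (big_ind2 (fun v s => W v /\ b v w = s)).
- by split; [exact: subspace0|exact: form0l].
- move=> v1 s1 v2 s2 [W1 <-] [W2 <-]; split; first exact: subspaceD.
  exact: formDl.
- by move=> i _; split; [exact: subspaceZ|exact: formZl].
Qed.

Lemma form_sumr n (x : 'I_n -> R) (e : 'I_n -> E) w :
  (forall i, W (e i)) -> W w ->
  b w (\sum_i x i *: e i) = \sum_i x i * b w (e i).
Proof.
move=> We Ww; rewrite formC//; last exact: subspace_sum.
by rewrite form_suml//; apply: eq_bigr => i _; rewrite formC.
Qed.

(** The quadratic form is nonnegative along all combinations of [v] and [w]; the
    form may vanish at [v], where there is no minimiser. *)
Lemma form_CS {v w} : W v -> W w -> b v w ^+ 2 <= b v v * b w w.
Proof.
move=> Wv Ww.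
have q (s t : R) : 0 <= s ^+ 2 * b v v - 2 * s * t * b v w + t ^+ 2 * b w w.
  have := form_ge0 (subspaceB hW _ _ (subspaceZ hW s _ Wv) (subspaceZ hW t _ Ww)).
  rewrite formBl ?formBr ?formZl ?formZr//; try exact: subspaceZ;
    try exact: (subspaceB hW); try (by apply: subspaceB => //; exact: subspaceZ).
  by rewrite (formC Ww Wv) => h; apply: le_trans h _; rewrite le_eqVlt; apply/orP; left;
    apply/eqP; ring.
(* the first instance is the rescaled minimiser, the others serve if [b v v = 0] *)
have := q (b v w) (b v v); have := q (b w w) (b v w); have := q 1 (b v w).
have := form_ge0 Wv; have := form_ge0 Ww.
move: (b v v) (b w w) (b v w) => x y z y0 x0 h1 h2 h3.
have [x00|x0'] := eqVneq x 0.
  by subst x; have [->|y0'] := eqVneq y 0; move: h1; rewrite ?x00; nra.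
have {x0'}x0 : 0 < x by rewrite lt_neqAle eq_sym x0' x0.
have : 0 <= x * (x * y - z ^+ 2) by nra.
by rewrite pmulr_rge0//; lra.
Qed.

Lemma form_ker {v w} : W v -> W w -> b v v = 0 -> b v w = 0.
Proof.
move=> Wv Ww v0; have := form_CS Wv Ww; rewrite v0 mul0r => h.
by apply/eqP; rewrite -sqrf_eq0 eq_le h sqr_ge0.
Qed.

Lemma form_pyth {v w} : W v -> W w -> b v w = 0 ->
  b (v + w) (v + w) = b v v + b w w.
Proof.
move=> Wv Ww vw; have Wvw : W (v + w) by exact: subspaceD.
by rewrite formDl// !formDr// (formC Ww)// vw addr0 add0r.
Qed.

End Form.
End Forms.

(** * Maximising a quotient of two forms *)

Lemma continuous_sumr {R : realType} {T : topologicalType} {I : Type}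
    (r : seq I) (P : pred I) (f : I -> T -> R) :
  (forall i, P i -> continuous (f i)) ->
  continuous (fun x => \sum_(i <- r | P i) f i x).
Proof. by move=> cf; apply: continuous_big => //; exact: add_continuous. Qed.

Lemma continuous_mulr {R : realType} {T : topologicalType} (f g : T -> R) :
  continuous f -> continuous g -> continuous (fun x => f x * g x).
Proof. by move=> cf cg x; apply: cvgM; [exact: cf|exact: cg]. Qed.

Section Maximum.
Context {R : realType} {E : lmodType R} {W : set E} (hW : subspace W)
  {b : E -> E -> R} (hb : psd_form W b).

(** On R^n, where n is the largest size of an orthonormal family, the quotient
    of [g] by [b] is a continuous function on the compact unit sphere; by
    maximality of the family, nothing is lost outside its span. *)
Lemma form_maximiser (A : set E) (g : E -> E -> R) (C : R) (M : nat) :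
  subspace A -> A `<=` W -> psd_form A g ->
  (forall v, A v -> g v v <= C * b v v) ->
  (forall n (e : 'I_n -> E), (forall i, A (e i)) ->
     (forall i j, b (e i) (e j) = (i == j)%:R) -> (n <= M)%N) ->
  (exists2 v, A v & b v v != 0) ->
  exists e, [/\ A e, b e e = 1 & forall v, A v -> g v v <= g e e * b v v].
Proof.
move=> hA AW hg gb fin [v0 Av0 bv0].
pose P n := `[< exists e : 'I_n -> E, (forall i, A (e i)) /\
  forall i j, b (e i) (e j) = (i == j)%:R >].
have P0 : P 0%N by apply/asboolP; exists (fun _ => 0); split; case.
have PM n : P n -> (n <= M)%N.
  by move=> /asboolP[e [Ae oe]]; exact: (fin _ e).
have [n /asboolP[e [Ae oe]] nmax] := @ex_maxnP P M (ex_intro (fun n => P n) _ P0) PM.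
have We i : W (e i) by exact: AW.
have ge v : A v -> 0 <= g v v by exact: (form_ge0 hg).
have be v : A v -> 0 <= b v v by move=> /AW; exact: (form_ge0 hb).
pose s (x : 'rV[R]_n) := \sum_i x ord0 i *: e i.
have As x : A (s x) by exact: (subspace_sum hA).
have bse x i : b (s x) (e i) = x ord0 i.
  rewrite (form_suml hW hb)// (bigD1 i)//= oe eqxx mulr1 big1 ?addr0// => j ji.
  by rewrite oe (negbTE ji) mulr0.
have bs x : b (s x) (s x) = \sum_i x ord0 i ^+ 2.
  rewrite (form_sumr hW hb)//; last exact: AW.
  by apply: eq_bigr => i _; rewrite bse expr2.
have gs x : g (s x) (s x) = \sum_i \sum_j x ord0 i * (x ord0 j * g (e i) (e j)).
  rewrite (form_suml hA hg)//; apply: eq_bigr => i _; rewrite -mulr_sumr.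
  by rewrite (form_sumr hA hg).
(* a residual orthogonal to the family is null, else it would extend it *)
have res0 v : A v -> (forall i, b v (e i) = 0) -> b v v = 0.
  move=> Av ve; apply/eqP/negPn/negP => bv; have Wv := AW _ Av.
  have bv1 : 0 < b v v by rewrite lt_neqAle eq_sym bv be.
  pose f (i : 'I_n.+1) := if unlift ord0 i is Some j then e j
    else (Num.sqrt (b v v))^-1 *: v.
  suff /nmax : P n.+1 by rewrite ltnn.
  apply/asboolP; exists f; split=> [i|i j].
    by rewrite /f; case: unliftP => [k _|_] //; exact: (subspaceZ hA).
  rewrite /f; case: unliftP => [k ->|->]; case: unliftP => [l ->|->].
  - by rewrite oe; congr (_ %:R); rewrite (inj_eq lift_inj).
  - rewrite (formC hb) ?(formZl hW hb) ?ve ?mulr0//; last exact: (subspaceZ hW).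
  - by rewrite (formZl hW hb) ?ve ?mulr0.
  - rewrite (formZl hW hb)// ?(formZr hW hb)//; last exact: (subspaceZ hW).
    by rewrite mulrA -invfM -expr2 sqr_sqrtr ?be// mulVf.
have npos : (0 < n)%N.
  rewrite lt0n; apply/negP => /eqP n0; move/eqP: bv0; apply.
  by apply: res0 => // i; exfalso; move: i; rewrite n0; case.
pose S := [set x : 'rV[R]_n | \sum_i x ord0 i ^+ 2 = 1].
have cc i : continuous (fun x : 'rV[R]_n => x ord0 i).
  by move=> x; exact: coord_continuous.
pose q (x : 'rV[R]_n) := g (s x) (s x).
have cq : continuous q.
  have -> : q = fun x => \sum_i \sum_j x ord0 i * (x ord0 j * g (e i) (e j)).
    by apply/funext => x; rewrite /q gs.
  apply: continuous_sumr => i _; apply: continuous_sumr => j _.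
  apply: continuous_mulr; first exact: cc.
  by apply: continuous_mulr; [exact: cc|exact: cst_continuous].
have cS : compact S.
  apply: bounded_closed_compact.
    exists 1; split; first exact: num_real.
    move=> y y1 x Sx; apply: le_trans (ltW y1).
    rewrite [leLHS]/Num.norm /= mx_normrE; apply/bigmax_leP; split => //=.
    move=> [i j] _ /=; rewrite ord1 -sqrtr_sqr -sqrtr1 ler_sqrt//.
    by rewrite -Sx (bigD1 j)//= lerDl sumr_ge0// => k _; exact: sqr_ge0.
  have -> : S = (fun x : 'rV[R]_n => \sum_i x ord0 i ^+ 2) @^-1` [set 1] by [].
  apply: preimage_closed; last exact: closed_eq.
  apply: in1W; apply: continuous_sumr => i _; under eq_fun do rewrite expr2.
  by apply: continuous_mulr; exact: cc.
have S0 : S !=set0.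
  exists (delta_mx ord0 (Ordinal npos)); rewrite /S/= (bigD1 (Ordinal npos))//=.
  rewrite big1 ?addr0; first by rewrite mxE !eqxx expr1n.
  by move=> i /negbTE i0; rewrite mxE i0 andbF expr0n.
have cqS : {within S, continuous q} by exact: continuous_subspaceT.
have [c /set_mem Sc maxc] := EVT_max_rV S0 cS cqS.
exists (s c); split; [exact: As|by rewrite bs|].
move=> v Av; pose x : 'rV[R]_n := \row_i b v (e i).
pose r := v - s x.
have Ar : A r by exact: (subspaceB hA).
have rE : v = s x + r by rewrite addrC subrK.
have Wsx : W (s x) by exact: AW.
have Wr := AW _ Ar.
have rorth i : b r (e i) = 0.
  by rewrite (formBl hb)//; [rewrite bse mxE subrr|exact: AW].
have br0 := res0 _ Ar rorth.
have gr0 : g r r = 0.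
  by apply/eqP; rewrite eq_le ge// andbT (le_trans (gb _ Ar))// br0 mulr0.
rewrite rE (form_pyth hA hg)//; last first.
  by rewrite (formC hg)//; apply: (form_ker hA hg).
rewrite (form_pyth hW hb)//; last first.
  by rewrite (formC hb)//; apply: (form_ker hW hb).
rewrite gr0 br0 !addr0.
have [x0|x0] := eqVneq (b (s x) (s x)) 0.
  by rewrite x0 mulr0 (le_trans (gb _ (As _)))// x0 mulr0.
have bx : 0 < b (s x) (s x) by rewrite lt_neqAle eq_sym x0 be.
pose t := (Num.sqrt (b (s x) (s x)))^-1.
have t2 : t ^+ 2 * b (s x) (s x) = 1.
  by rewrite exprVn sqr_sqrtr ?be// mulVf.
have sZ : s (t *: x) = t *: s x.
  by rewrite /s scaler_sumr; apply: eq_bigr => i _; rewrite mxE scalerA.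
have Stx : S (t *: x).
  rewrite /S/= -bs sZ (formZl hW hb)// ?(formZr hW hb)//; last exact: (subspaceZ hW).
  by rewrite mulrA -expr2.
have := maxc _ (mem_set Stx); rewrite /q sZ (formZl hA hg)//;
  last exact: (subspaceZ hA).
rewrite (formZr hA hg)// mulrA -expr2 => h.
have : 0 <= b (s x) (s x) * (g (s c) (s c) - t ^+ 2 * g (s x) (s x)).
  by rewrite mulr_ge0// ?subr_ge0// ltW.
move: t2 h; move: (g (s c) _) (g (s x) _) (b (s x) _) => p y z t2 h.
have -> : z * (p - t ^+ 2 * y) = p * z - (t ^+ 2 * z) * y by ring.
by rewrite t2 mul1r subr_ge0.
Qed.
End Maximum.

(** * Quasi-optimality for abstract forms *)

Section QuasiOptimality.
Context {R : realType} {E : lmodType R} {W : set E} (hW : subspace W)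
  {b : E -> E -> R} (hb : psd_form W b).
Variables (V A : set E) (I J : E -> E).
Hypotheses (hA : subspace A) (VW : V `<=` W) (AW : A `<=` W).
Hypothesis IV : forall v, V v -> A (I v).
Hypothesis I_orth : forall v w, V v -> A w -> b (v - I v) w = 0.
Hypothesis JA : forall v, A v -> V (J v).
Hypothesis J_lin : forall (a : R) v w, A v -> A w ->
  let r := J (a *: v + w) - (a *: J v + J w) in b r r = 0.
Hypothesis J_orth : forall v w, A v -> A w -> b (J v - v) w = 0.

(** The abstract form of the modified scheme for the right-hand side
    [b u _] tested with [J v] *)
Definition scheme u w : Prop := A w /\ forall v, A v -> b w v = b u (J v).

Definition defect v w : R := b (v - J v) (w - J w).

Let Wd v : A v -> W (v - J v).
Proof. by move=> Av; apply: (subspaceB hW); [exact: AW|exact/VW/JA]. Qed.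

Let We u : V u -> W (u - I u).
Proof. by move=> Vu; apply: (subspaceB hW); [exact: VW|exact/AW/IV]. Qed.

(** [J] is linear only up to null vectors, which a semidefinite form does not
    see. *)
Lemma defect_psd : psd_form A defect.
Proof.
split=> [v w Av Aw|a u v w Au Av Aw|v Av].
- by rewrite /defect (formC hb)//; exact: Wd.
- have Auv : A (a *: u + v) by case: hA => _; apply.
  pose r := J (a *: u + v) - (a *: J u + J v).
  have Wr : W r.
    apply: (subspaceB hW); first exact/VW/JA.
    by case: hW => _; apply; exact/VW/JA.
  have -> : defect (a *: u + v) w = b (a *: (u - J u) + (v - J v) - r) (w - J w).
    congr (b _ _); rewrite /r scalerBr opprB [_ + (v - J v)]addrACA -opprD.
    by rewrite [in RHS]addrA subrK.
  have Wud : W (a *: (u - J u) + (v - J v)).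
    by case: hW => _; apply; exact: Wd.
  rewrite (formBl hb) ?(formZDl hb)//; try exact: Wd.
  by rewrite (form_ker hW hb Wr) ?subr0//; [exact: Wd|exact: J_lin].
- by apply: (form_ge0 hb); exact: Wd.
Qed.

(** The interpolation error is orthogonal to the discrete space, hence
    Pythagoras. *)
Lemma error_split u w : V u -> A w ->
  b (u - w) (u - w) = b (u - I u) (u - I u) + b (I u - w) (I u - w).
Proof.
move=> Vu Aw; have AIw : A (I u - w) by apply: (subspaceB hA) => //; exact: IV.
rewrite -(form_pyth hW hb) ?I_orth//; [|exact: We|exact: AW].
by rewrite addrA subrK.
Qed.

(** The discrete part of the error sees the data only through the interpolation
    error: [I u] may be traded for [u] on the left, and subtracted from [u] on
    the right, because both [u - I u] and [v - J v] are orthogonal to the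
    discrete space. *)
Lemma scheme_error u w : V u -> A w ->
  scheme u w <-> forall v, A v -> b (I u - w) v = b (u - I u) (v - J v).
Proof.
move=> Vu Aw.
have key v : A v -> b (I u - w) v - b (u - I u) (v - J v) = b u (J v) - b w v.
  move=> Av; have WJ := VW _ (JA _ Av); have Wu := VW _ Vu.
  have WI := AW _ (IV _ Vu); have Wv := AW _ Av.
  have := I_orth _ _ Vu Av; rewrite (formBl hb Wu WI Wv) => h1.
  have := J_orth _ _ Av (IV _ Vu);
  rewrite (formC hb (subspaceB hW _ _ WJ Wv) WI) (formBr hW hb WI WJ Wv).
  move=> h2; have Ww := AW _ Aw.
  rewrite (formBl hb WI Ww Wv) (formBr hW hb (We _ Vu) Wv WJ).
  rewrite (formBl hb Wu WI Wv) (formBl hb Wu WI WJ).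
  lra.
split=> [[_ h] v Av|h]; first by have := key _ Av; rewrite h//; lra.
by split=> // v Av; have := key _ Av; rewrite h//; lra.
Qed.

(** The discrete part [d] of the error satisfies [b d d = b (u - I u) (d - J d)],
    and the seminorm of [d - J d] is at most [L] times that of [d]. *)
Lemma quasi_optimal (L : R) u w : 0 <= L ->
  (forall v, A v -> defect v v <= L ^+ 2 * b v v) ->
  V u -> scheme u w ->
  b (u - w) (u - w) <= (1 + L ^+ 2) * b (u - I u) (u - I u).
Proof.
move=> L0 hL Vu uw; have Aw := uw.1; rewrite error_split// mulrDl mul1r lerD2l.
have Ad : A (I u - w) by apply: (subspaceB hA) => //; exact: IV.
have /scheme_error := uw => /(_ Vu Aw) /(_ _ Ad) dd.
have := form_CS hW hb (We _ Vu) (Wd _ Ad); rewrite -dd => cs.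
have := hL _ Ad; rewrite /defect => hd.
have := form_ge0 hb (AW _ Ad); have := form_ge0 hb (We _ Vu).
move: cs hd; move: (b (I u - w) _) (b (u - I u) _) (b (_ - _ - _) _) => x y z.
move=> cs hd y0 x0; have [->|xn0] := eqVneq x 0.
  by rewrite mulr_ge0// sqr_ge0.
have xp : 0 < x by rewrite lt_neqAle eq_sym xn0.
rewrite -(ler_pM2l xp) -expr2 (le_trans cs)//.
have -> : x * (L ^+ 2 * y) = y * (L ^+ 2 * x) by ring.
by rewrite ler_wpM2l.
Qed.

(** A maximiser [e] of the defect is an eigenvector of it, because
    [L ^+ 2 * b - defect] is a semidefinite form vanishing at [e]; hence
    equality holds in each estimate of the upper bound for [u = J e]. *)
Lemma quasi_optimal_sharp (L : R) e : A e -> b e e = 1 -> defect e e = L ^+ 2 ->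
  (forall v, A v -> defect v v <= L ^+ 2 * b v v) ->
  (exists2 u, V u & b (u - I u) (u - I u) != 0) ->
  exists u, [/\ V u, exists w, scheme u w, 0 < b (u - I u) (u - I u) &
    forall w, scheme u w ->
      b (u - w) (u - w) = (1 + L ^+ 2) * b (u - I u) (u - I u)].
Proof.
move=> Ae ee Le hL [u0 Vu0 u00].
have [L0|L0] := eqVneq L 0.
  exists u0; split => //.
  - exists (I u0); apply/(scheme_error _ _ Vu0 (IV _ Vu0)) => v Av.
    have W0 := subspace0 hW.
    rewrite subrr (form0l hW hb (AW _ Av)) (formC hb (We _ Vu0) (Wd _ Av)).
    rewrite (form_ker hW hb (Wd _ Av) (We _ Vu0))//; apply/eqP.
    rewrite eq_le (form_ge0 hb (Wd _ Av)) andbT.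
    by have := hL _ Av; rewrite L0 expr0n mul0r.
  - by rewrite lt_neqAle eq_sym u00 (form_ge0 hb (We _ Vu0)).
  - move=> w uw; apply/eqP; rewrite eq_le; apply/andP; split.
      by apply: quasi_optimal => //; rewrite L0.
    rewrite L0 expr0n addr0 mul1r (error_split _ _ Vu0 uw.1) lerDl.
    by apply: (form_ge0 hb); apply/AW/(subspaceB hA); [exact: IV|exact: uw.1].
have hpsd : psd_form A (fun v w => L ^+ 2 * b v w - defect v w).
  split=> [v w Av Aw|a u v w Au Av Aw|v Av].
  - by rewrite (formC hb (AW _ Av) (AW _ Aw)) (formC defect_psd Av Aw).
  - rewrite (formZDl hb) ?(formZDl defect_psd)//; try exact: AW.
    ring.
  - by rewrite subr_ge0 hL.
have eig v : A v -> defect e v = L ^+ 2 * b e v.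
  move=> Av; have := form_ker hA hpsd Ae Av; rewrite /= Le ee mulr1 subrr.
  by move=> /(_ erefl) h; lra.
have Vu := JA _ Ae; set u := J e in Vu *.
have AIe : A (I u - e) by apply: (subspaceB hA) => //; exact: IV.
(* both differ from [J e] by a vector orthogonal to the discrete space *)
have Iue v : A v -> b (I u - e) v = 0.
  move=> Av; have Wv := AW _ Av; have WI := AW _ (IV _ Vu).
  have := I_orth _ _ Vu Av; have := J_orth _ _ Ae Av; rewrite -/u.
  rewrite !(formBl hb)//; try exact: AW; try exact: VW.
  lra.
have Iue0 w : W w -> b (I u - e) w = 0.
  by move=> Ww; apply: (form_ker hW hb) => //; [exact: AW|exact: Iue].
have uIu w : W w -> b (u - I u) w = - b (e - u) w.
  move=> Ww; have := Iue0 _ Ww; rewrite !(formBl hb)//; try exact: AW;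
    try exact: VW; try exact/AW/IV.
  lra.
have uIu2 : b (u - I u) (u - I u) = L ^+ 2.
  rewrite (uIu _ (We _ Vu)) (formC hb (Wd _ Ae) (We _ Vu)) (uIu _ (Wd _ Ae)).
  by rewrite opprK.
have L2 : 0 < L ^+ 2 by rewrite exprn_even_gt0.
(* the discrete error [I u - w] is [- L ^+ 2 *: e] *)
exists u; split => //.
- exists ((1 + L ^+ 2) *: e); apply/scheme_error => //; first exact: (subspaceZ hA).
  move=> v Av; rewrite (uIu _ (Wd _ Av)) -/(defect e v) (eig _ Av).
  have Wv := AW _ Av; have We' := AW _ Ae; have WI := AW _ (IV _ Vu).
  have := Iue _ Av; rewrite (formBl hb WI We' Wv).
  rewrite (formBl hb WI (subspaceZ hW _ _ We') Wv) (formZl hW hb _ We' Wv).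
  lra.
- by rewrite uIu2.
move=> w uw; have Aw := uw.1; rewrite error_split// uIu2 mulrDl mul1r; congr (_ + _).
have Ad : A (I u - w) by apply: (subspaceB hA) => //; exact: IV.
have de v : A v -> b (I u - w) v = - (L ^+ 2 * b e v).
  move=> Av; move/scheme_error : uw => /(_ Vu Aw) ->//.
  by rewrite (uIu _ (Wd _ Av)) -/(defect e v) (eig _ Av).
rewrite (de _ Ad) (formC hb (AW _ Ae) (AW _ Ad)) (de _ Ae) ee.
ring.
Qed.

End QuasiOptimality.

Arguments defect {R E} b J v w.
Arguments scheme {R E} b A J u w.

(** * The functions [p(1/y) exp(-1/y)] *)

Section Flat.
Context {R : realType}.
Implicit Types (p : {poly R}) (x y : R).

(** The derivative of [p(1/y) exp(-1/y)] is again of this form, which makes the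
    family of these functions stable under differentiation. *)
Definition flat p y : R := if 0 < y then p.[y^-1] * expR (- y^-1) else 0.

(** Half of the exponential decay is spent on each factor [y] of the polynomial,
    by [t <= expR t]. *)
Lemma poly_expR_bounded p (a : R) : 0 < a ->
  exists2 C, 0 <= C & forall y, 0 <= y -> `|p.[y]| * expR (- (a * y)) <= C.
Proof.
elim/poly_ind: p a => [|p c ih] a a0.
  by exists 0 => // y _; rewrite horner0 normr0 mul0r.
have a2 : 0 < a / 2 by rewrite divr_gt0.
have [C C0 hC] := ih _ a2.
exists (C * (a / 2)^-1 + `|c|).
  by rewrite addr_ge0// mulr_ge0// invr_ge0 ltW.
move=> y y0; rewrite hornerMXaddC.
have y1 : y * expR (- (a / 2 * y)) <= (a / 2)^-1.
  rewrite expRN ler_pdivrMr ?expR_gt0// -ler_pdivrMl ?invr_gt0// invrK.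
  by apply: le_trans (expR_ge1Dx _); rewrite lerDr.
apply: (@le_trans _ _ ((`|p.[y] * y| + `|c|) * expR (- (a * y)))).
  by rewrite ler_wpM2r ?expR_ge0// ler_normD.
rewrite mulrDl lerD//; last first.
  rewrite ler_piMr// -expR0 ler_expR oppr_le0 mulr_ge0// ltW//.
rewrite (_ : - (a * y) = - (a / 2 * y) + - (a / 2 * y)); last by field.
rewrite expRD normrM (ger0_norm y0) mulrACA.
by apply: ler_pM; rewrite ?mulr_ge0 ?expR_ge0//; exact: hC.
Qed.

(** Difference quotients at the origin stay within the family. *)
Lemma flatMX p y : flat p y = flat (p * 'X) y * y.
Proof.
rewrite /flat; case: ltP => y0; last by rewrite mul0r.
by rewrite hornerMX [RHS]mulrAC mulfVK// gt_eqF.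
Qed.

Lemma flat0 p : flat p 0 = 0. Proof. by rewrite /flat ltxx. Qed.

Lemma flat_bounded p : exists2 C, 0 <= C & forall y, `|flat p y| <= C.
Proof.
have [C C0 hC] := poly_expR_bounded p _ ltr01.
exists C => // y; rewrite /flat; case: ltP => y0; last by rewrite normr0.
rewrite normrM (ger0_norm (expR_ge0 _)) -[X in - X]mul1r hC// invr_ge0 ltW//.
Qed.

Lemma flat_continuous0 p : {for 0, continuous (flat p)}.
Proof.
rewrite /prop_for /continuous_at flat0.
have [C C0 hC] := flat_bounded (p * 'X).
apply/norm_cvg0P.
apply: (@squeeze_cvgr _ _ _ _ (fun=> 0) (fun y => C * `|y|)).
- near=> y; rewrite normr_ge0/= flatMX normrM ler_wpM2r//.
- exact: cvg_cst.
- rewrite -[X in _ --> X](mulr0 C); apply: cvgM; first exact: cvg_cst.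
  by rewrite -[X in _ --> X](normr0 R); apply: cvg_norm; exact: cvg_id.
Unshelve. all: by end_near.
Qed.

Definition flat_deriv p := (p - p^`()) * 'X^2.

Lemma flat_is_derive p y : is_derive y 1 (flat p) (flat (flat_deriv p) y).
Proof.
have [y0|y0|->] := ltgtP y 0.
- rewrite (_ : flat (flat_deriv p) y = 0); last by rewrite /flat ltNge (ltW y0).
  have h : \near y, cst 0 y = flat p y.
    near=> z; rewrite /flat ifN// -leNgt; apply: ltW; near: z.
    exact: lt_nbhsl.
  exact: near_eq_is_derive h (is_derive_cst _ _ _).
- have h : \near y, p.[y^-1] * expR (- y^-1) = flat p y.
    by near=> z; rewrite /flat ifT//; near: z; exact: lt_nbhsr.
  apply: (near_eq_is_derive h).
  have dV : is_derive y 1 (fun z : R => z^-1) (- y ^- 2).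
    apply: DeriveDef; first by apply: derivableV => //; rewrite gt_eqF.
    by rewrite deriveV ?gt_eqF// derive_id /GRing.scale/= mulr1.
  have d1 : is_derive y 1 (fun z => p.[z^-1]) (- y ^- 2 * p^`().[y^-1]).
    rewrite mulrC.
    exact: (@is_derive1_comp _ (horner p) _ _ _ _ (is_derive_poly p y^-1) dV).
  have d2 : is_derive y 1 (fun z => expR (- z^-1)) (y ^- 2 * expR (- y^-1)).
    rewrite -[y ^- 2]opprK mulrC.
    exact: (@is_derive1_comp _ expR (fun z => - z^-1) y _ _
      (is_derive_expR (- y^-1)) (is_deriveN dV)).
  have := is_deriveM d1 d2.
  set a := (X in is_derive _ _ _ X); suff <- : a = flat (flat_deriv p) y by [].
  rewrite /a.
  rewrite /flat y0 /flat_deriv !hornerE /GRing.scale/= expr2 invfM; ring.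
(* at the origin the difference quotient is [flat (p * 'X)], continuous there *)
- apply/is_derive1_caratheodory; exists (flat (p * 'X)).
  rewrite !flat0; split => //.
  + by move=> z; rewrite !subr0 -flatMX.
  + exact: flat_continuous0.
Unshelve. all: by end_near.
Qed.

End Flat.

(** * A class of smooth functions *)

Section Elementary.
Context {R : realType}.
Implicit Types (f g : R * R -> R) (v x : R * R).

(** A class closed under the partial derivatives and consisting of
    differentiable functions consists of smooth functions: membership alone
    gives all derivatives at once. *)
Inductive elementary : (R * R -> R) -> Prop :=
| elementary_cst c : elementary (fun=> c)
| elementary_fst : elementary (fun x => x.1)
| elementary_snd : elementary (fun x => x.2)
| elementaryD f g : elementary f -> elementary g ->
    elementary (fun x => f x + g x)
| elementaryM f g : elementary f -> elementary g ->
    elementary (fun x => f x * g x)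
| elementary_flat p f : elementary f -> elementary (fun x => flat p (f x)).

Lemma flat_differentiable p (y : R) : differentiable (flat p) y.
Proof. by apply/derivable1_diffP; case: (flat_is_derive p y). Qed.

Lemma elementary_differentiable f x : elementary f -> differentiable f x.
Proof.
elim=> [c|||g h _ dg _ dh|g h _ dg _ dh|p g _ dg].
- exact: differentiable_cst.
- by apply: (@linear_differentiable _ _ _ fst) => y; exact: cvg_fst.
- by apply: (@linear_differentiable _ _ _ snd) => y; exact: cvg_snd.
- exact: differentiableD.
- exact: differentiableM.
- exact: (differentiable_comp dg (flat_differentiable p _)).
Qed.

Lemma derive_flat p f x v : differentiable f x ->
  'D_v (fun x => flat p (f x)) x = flat (flat_deriv p) (f x) * 'D_v f x.
Proof.
move=> df; have dp := flat_differentiable p (f x).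
have -> : (fun x => flat p (f x)) = flat p \o f by [].
rewrite deriveE; last exact: differentiable_comp.
rewrite diff_comp//= -[X in 'd _ _ X](mulr1 ('d f x v)) linearZ/=.
rewrite -deriveE// -deriveE//; have := flat_is_derive p (f x) => -[_ ->].
by rewrite /GRing.scale/= mulrC.
Qed.

Lemma elementary_derive f v : elementary f -> elementary ('D_v f).
Proof.
move=> ef; elim: ef => [c|||g h eg dg eh dh|g h eg dg eh dh|p g eg dg].
- have -> : 'D_v (fun=> c) = fun _ : R * R => 0.
    by apply/funext => x; exact: derive_cst.
  exact: elementary_cst.
- have -> : 'D_v (fun x => x.1) = fun _ : R * R => v.1.
    have c : continuous (@fst R R) by move=> y; exact: cvg_fst.
    apply/funext => x; rewrite deriveE ?(diff_lin _ c)//.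
    exact: linear_differentiable.
  exact: elementary_cst.
- have -> : 'D_v (fun x => x.2) = fun _ : R * R => v.2.
    have c : continuous (@snd R R) by move=> y; exact: cvg_snd.
    apply/funext => x; rewrite deriveE ?(diff_lin _ c)//.
    exact: linear_differentiable.
  exact: elementary_cst.
- have -> : 'D_v (fun x => g x + h x) = fun x => 'D_v g x + 'D_v h x.
    apply/funext => x; rewrite -deriveD//;
      exact/diff_derivable/elementary_differentiable.
  exact: elementaryD.
- have -> : 'D_v (fun x => g x * h x) = fun x => g x * 'D_v h x + h x * 'D_v g x.
    apply/funext => x; rewrite -deriveM//;
      exact/diff_derivable/elementary_differentiable.
  by apply: elementaryD; apply: elementaryM.
- have -> : 'D_v (fun x => flat p (g x)) =
      fun x => flat (flat_deriv p) (g x) * 'D_v g x.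
    apply/funext => x; apply: derive_flat.
    exact: elementary_differentiable.
  by apply: elementaryM => //; exact: elementary_flat.
Qed.

Lemma elementary_partials s f : elementary f -> elementary (partials s f).
Proof. by move=> ef; elim: s => //= i s; exact: elementary_derive. Qed.

Lemma elementary_smooth f : elementary f -> smooth f.
Proof.
move=> ef s; have es := elementary_partials s _ ef; split=> [x|i x].
  exact/differentiable_continuous/elementary_differentiable.
exact/diff_derivable/elementary_differentiable.
Qed.

End Elementary.

(** * Open sets and rectangles of the plane *)

Section Plane.
Context {R : realType}.
Implicit Types (A : set (R * R)) (x : R * R).

(** The product sigma-algebra of the plane, as opposed to its product topology *)
Local Notation plane := (measurableTypeR R * measurableTypeR R)%type.

Definition rect (a b c d : R) : set (R * R) := `]a, b[%classic `*` `]c, d[%classic.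
Definition crect (a b c d : R) : set (R * R) := `[a, b]%classic `*` `[c, d]%classic.

Lemma rect_subset a b c d : rect a b c d `<=` crect a b c d.
Proof. by move=> x [h1 h2]; split; apply: subset_itv_oo_cc. Qed.

Lemma measurable_rect a b c d : measurable (rect a b c d : set plane).
Proof. exact: measurableX. Qed.

(** Countably many rectangles suffice, those with a rational centre and half
    width the inverse of an integer; this is what makes open sets measurable for the product
    sigma-algebra, and what turns statements on rectangles into statements
    almost everywhere. *)
Lemma open_rectangle_cover A : open A ->
  exists a b c d : nat -> R,
    (forall n, crect (a n) (b n) (c n) (d n) `<=` A) /\
    A `<=` \bigcup_n rect (a n) (b n) (c n) (d n).
Proof.
move=> oA.
pose r (n : nat) : R := n.+1%:R^-1.
pose lo (q : rat) n : R := ratr q - r n.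
pose hi (q : rat) n : R := ratr q + r n.
pose ok (q : rat * rat * nat) := `[< crect (lo q.1.1 q.2) (hi q.1.1 q.2)
  (lo q.1.2 q.2) (hi q.1.2 q.2) `<=` A >].
(* an empty rectangle for the codes that do not fit *)
pose get (f : rat * rat * nat -> R) (z : R) n :=
  if unpickle n is Some q then if ok q then f q else z else z.
exists (get (fun q => lo q.1.1 q.2) 1), (get (fun q => hi q.1.1 q.2) 0),
  (get (fun q => lo q.1.2 q.2) 1), (get (fun q => hi q.1.2 q.2) 0); split.
  move=> n; rewrite /get; case: unpickle => [q|]; last first.
    by move=> x [] /=; rewrite in_itv/= => /andP[/le_trans h /h]; rewrite ler10.
  have [okq|_] := boolP (ok q); first exact/asboolP.
  by move=> x [] /=; rewrite in_itv/= => /andP[/le_trans h /h]; rewrite ler10.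
move=> x Ax; have /nbhs_ballP[e /= e0 xeA] : nbhs x A by exact: open_nbhs_nbhs.
have [n ne] : exists n : nat, r n < e / 2.
  have e2 : 0 < e / 2 by rewrite divr_gt0.
  exists (Num.truncn (e / 2)^-1); rewrite /r -[ltRHS]invrK ltf_pV2 ?posrE ?invr_gt0//.
  by rewrite truncnS_gt.
have n0 : 0 < r n by rewrite invr_gt0.
have near_rat (y : R) : exists q : rat, `|y - ratr q| < r n.
  have /rat_in_itvoo[q] : y - r n < y + r n by lra.
  rewrite in_itv/= => /andP[h1 h2]; exists q.
  by rewrite ltr_norml; apply/andP; split; lra.
have [q1 h1] := near_rat x.1; have [q2 h2] := near_rat x.2.
have okq : ok (q1, q2, n).
  apply/asboolP => z [] /=; rewrite !in_itv/= /lo /hi.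
  move=> /andP[z1 z1'] /andP[z2 z2']; apply: xeA.
  move: h1 h2; rewrite !ltr_norml => /andP[? ?] /andP[? ?].
  by split; rewrite /ball /= ltr_norml; apply/andP; split; lra.
exists (pickle (q1, q2, n)) => //; rewrite /get pickleK okq /=.
move: h1 h2; rewrite !ltr_norml => /andP[? ?] /andP[? ?].
by split; rewrite /= in_itv/= /lo /hi; apply/andP; split; lra.
Qed.

Lemma open_measurable_plane A : open A -> measurable (A : set plane).
Proof.
move=> /open_rectangle_cover[a [b [c [d [sub cov]]]]].
have -> : A = \bigcup_n rect (a n) (b n) (c n) (d n).
  by apply/seteqP; split => // x [n _ rx]; exact/(sub n)/rect_subset.
by apply: bigcupT_measurable => n; exact: measurable_rect.
Qed.

Lemma continuous_measurable_plane (f : R * R -> R) :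
  continuous f -> measurable_fun setT (f : plane -> R).
Proof.
move=> /continuousP cf; apply: (measurability _ (RGenOpens.measurableE R)).
move=> _ [_ [a [b ->] <-]]; rewrite setTI; apply: open_measurable_plane.
exact/cf/interval_open.
Qed.

Lemma closed_measurable_plane A : closed A -> measurable (A : set plane).
Proof. by move/closed_openC/open_measurable_plane/measurableC; rewrite setCK. Qed.

End Plane.

(** * Square-integrable functions *)

Section SquareIntegrable.
Context {R : realType}.
Implicit Types (U V : set (R * R)) (f g h : R * R -> R).

Local Notation plane := (measurableTypeR R * measurableTypeR R)%type.
Local Notation mu := (@leb2 R).

Instance leb2_ae_filter : Filter (almost_everywhere mu).
Proof. exact: ae_filter_ringOfSetsType. Qed.

Lemma leb2_aeS (P Q : R * R -> Prop) : (forall x, P x -> Q x) ->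
  (\forall x \ae mu, P x) -> \forall x \ae mu, Q x.
Proof. exact: (@filterS _ _ leb2_ae_filter). Qed.

Lemma leb2_aeS2 (P Q S : R * R -> Prop) : (forall x, P x -> Q x -> S x) ->
  (\forall x \ae mu, P x) -> (\forall x \ae mu, Q x) -> \forall x \ae mu, S x.
Proof. exact: (@filterS2 _ _ leb2_ae_filter). Qed.

Lemma L2P {U f} : measurable (U : set plane) ->
  L2 U f <-> measurable_fun (U : set plane) f /\
             mu.-integrable U (EFin \o (fun x => f x ^+ 2)).
Proof.
move=> mU; have sq : (fun x => (f \_ U) x ^+ 2) = (fun x => f x ^+ 2) \_ U.
  by apply/funext => x; rewrite /patch; case: ifP => // _; rewrite expr0n.
split=> [fL|[mf intf]].
  have := fL; rewrite /L2 inE => /andP[]; rewrite inE /= => mf _; split.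
    by have /(measurable_restrictT f mU) := mf.
  have := Lfun2_integrable_sqr fL; rewrite sq => h.
  by apply/(integrable_mkcond _ mU); rewrite restrict_EFin.
have mfU : measurable_fun setT (f \_ U : plane -> R).
  by apply/(measurable_restrictT f mU).
rewrite /L2 inE; apply/andP; split; first by rewrite inE.
rewrite inE /= /finite_norm unlock /Lnorm poweR_lty//.
have := intf => /(integrable_mkcond _ mU); rewrite restrict_EFin -sq => intf'.
have := integrable_lty measurableT intf'; apply: le_lt_trans.
rewrite le_eqVlt; apply/orP; left; apply/eqP; apply: eq_integral => x _ /=.
by rewrite powR_mulrn// real_normK// num_real.
Qed.

Lemma L2_measurable {U f} : measurable (U : set plane) -> L2 U f ->
  measurable_fun (U : set plane) f.
Proof. by move=> mU /(L2P mU)[]. Qed.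

Lemma L2_mul_integrable {U f g} : measurable (U : set plane) ->
  L2 U f -> L2 U g -> mu.-integrable U (EFin \o (fun x => f x * g x)).
Proof.
move=> mU /(L2P mU)[mf intf] /(L2P mU)[mg intg].
apply: le_integrable (integrableD mU intf intg) => //.
  by apply/measurable_EFinP; exact: measurable_funM.
move=> x _ /=. rewrite lee_fin.
rewrite [leRHS]ger0_norm ?addr_ge0 ?sqr_ge0// normrM.
rewrite -(real_normK (num_real (f x))) -(real_normK (num_real (g x))).
move: (`|f x|) (`|g x|) (normr_ge0 (f x)) (normr_ge0 (g x)) => a b a0 b0.
nra.
Qed.

Lemma L2_linear {U f g} (a : R) : measurable (U : set plane) ->
  L2 U f -> L2 U g -> L2 U (fun x => a * f x + g x).
Proof.
move=> mU fL gL; have fg := L2_mul_integrable mU fL gL.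
move/(L2P mU) : fL => [mf intf]; move/(L2P mU) : gL => [mg intg].
apply/(L2P mU); split.
  by apply: measurable_funD => //; apply: measurable_funM => //; exact: measurable_cst.
have := integrableD mU (integrableD mU (integrableZl mU (a ^+ 2) intf)
  (integrableZl mU (2 * a) fg)) intg.
apply: eq_integrable => // x _ /=; rewrite -!EFinM -!EFinD; congr EFin; ring.
Qed.

Lemma L2_0 U : measurable (U : set plane) -> L2 U (cst 0).
Proof.
move=> mU; apply/(L2P mU); split; first exact: measurable_cst.
apply: (eq_integrable mU (cst 0%E)); last exact: integrable0.
by move=> x _ /=; rewrite expr0n.
Qed.

Lemma L2_subset {U V f} : measurable (U : set plane) ->
  measurable (V : set plane) -> V `<=` U -> L2 U f -> L2 V f.
Proof.
move=> mU mV VU /(L2P mU)[mf intf]; apply/(L2P mV); split.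
  exact: measurable_funS VU mf.
exact: (integrableS mU mV VU).
Qed.

Lemma bounded_L2 {U f} (C : R) : measurable (U : set plane) -> (mu U < +oo)%E ->
  measurable_fun (U : set plane) f -> (forall x, U x -> `|f x| <= C) -> L2 U f.
Proof.
move=> mU fU mf fC; apply/(L2P mU); split => //.
apply: measurable_bounded_integrable => //; first exact: measurable_funX.
exists (C ^+ 2); split; first exact: num_real.
move=> y Cy x Ux /=; apply: le_trans (ltW Cy).
by rewrite normrX lerXn2r ?nnegrE// ?fC// (le_trans _ (fC _ Ux)).
Qed.

(** The entries of the tensors of derivatives are paired through this form. *)
Definition ip U f g : R := \int[mu]_(x in U) (f x * g x).

Lemma ipC U f g : ip U f g = ip U g f.
Proof. by apply: eq_Rintegral => x _; rewrite mulrC. Qed.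

Lemma ip_linear {U f g h} (a : R) : measurable (U : set plane) ->
  L2 U f -> L2 U g -> L2 U h ->
  ip U (fun x => a * f x + g x) h = a * ip U f h + ip U g h.
Proof.
move=> mU fL gL hL.
have fh := L2_mul_integrable mU fL hL; have gh := L2_mul_integrable mU gL hL.
rewrite /ip -RintegralZl// -RintegralD//; last exact: (integrableZl mU a fh).
by apply: eq_Rintegral => x _; ring.
Qed.

Lemma ip_ge0 U f : 0 <= ip U f f.
Proof. by apply: Rintegral_ge0 => x _; rewrite -expr2 sqr_ge0. Qed.

Lemma ae_Rintegral U f g : measurable (U : set plane) ->
  measurable_fun (U : set plane) f -> measurable_fun (U : set plane) g ->
  f = g %[ae mu in U] -> \int[mu]_(x in U) f x = \int[mu]_(x in U) g x.
Proof.
move=> mU mf mg fg; congr fine; apply: ae_eq_integral => //;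
  try exact/measurable_EFinP.
by apply: leb2_aeS fg => x + Ux => -> .
Qed.

Lemma ae_ip {U f f' g g'} : measurable (U : set plane) ->
  L2 U f -> L2 U g -> L2 U f' -> L2 U g' ->
  f = f' %[ae mu in U] -> g = g' %[ae mu in U] -> ip U f g = ip U f' g'.
Proof.
move=> mU fL gL fL' gL' ff gg; apply: ae_Rintegral => //.
- by apply: measurable_funM; exact: L2_measurable.
- by apply: measurable_funM; exact: L2_measurable.
- by apply: leb2_aeS2 ff gg => x h1 h2 Ux; rewrite h1// h2.
Qed.

End SquareIntegrable.

(** * Integrals of derivatives of compactly supported functions *)

Section IntegrationByParts.
Context {R : realType}.
Implicit Types (U K : set (R * R)) (f g h phi : R * R -> R) (x : R * R).

Local Notation plane := (measurableTypeR R * measurableTypeR R)%type.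
Local Notation mu := (@leb2 R).
Local Notation lambda := (@lebesgue_measure R).

Definition square (M : R) : set (R * R) := `[- M, M]%classic `*` `[- M, M]%classic.

Lemma norm_square (M : R) x : square M x <-> `|x| <= M.
Proof.
rewrite prod_normE ge_max /square /= !in_itv/= !ler_norml; split.
  by move=> [-> ->].
by move=> /andP[].
Qed.

Lemma measurable_square (M : R) : measurable (square M : set plane).
Proof. exact: measurableX. Qed.

Lemma leb2_rectangle (A B : set R) :
  measurable (A : set (measurableTypeR R)) ->
  measurable (B : set (measurableTypeR R)) ->
  mu (A `*` B) = (lambda A * lambda B)%E.
Proof. by move=> mA mB; exact: product_measure1E. Qed.

Lemma square_lty (M : R) : (mu (square M) < +oo)%E.
Proof.
rewrite leb2_rectangle//= !lebesgue_measure_itv/=.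
by case: ifP => _; rewrite ?mule0// -!EFinD -EFinM ltry.
Qed.

Lemma compact_square (M : R) : compact (square M).
Proof. by apply: compact_setX; exact: segment_compact. Qed.

Lemma continuous_square_bounded (M : R) f : continuous f ->
  exists C, forall x, square M x -> `|f x| <= C.
Proof.
move=> cf; have : bounded_set (f @` square M).
  apply/compact_bounded/continuous_compact; last exact: compact_square.
  exact: continuous_subspaceT.
move=> [C [_ hC]]; exists (C + 1) => x Mx; apply: hC; last by exists x.
by rewrite ltrDl.
Qed.

Lemma continuous_csupp_integrable (M : R) f : continuous f ->
  (forall x, M < `|x| -> f x = 0) -> mu.-integrable setT (EFin \o f).
Proof.
move=> cf f0; have [C hC] := continuous_square_bounded M f cf.
have mf := continuous_measurable_plane _ cf.
have mM := measurable_square M.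
have fE : f \_ (square M) = f.
  apply/funext => x; rewrite /patch; case: ifPn => // /negP Mx; rewrite f0//.
  by rewrite ltNge; apply/negP => /norm_square /mem_set.
rewrite -fE -restrict_EFin; apply/(integrable_mkcond _ mM).
apply: measurable_bounded_integrable => //; first exact: square_lty.
  exact: measurable_funTS.
exists C; split; first exact: num_real.
by move=> y Cy x Mx; apply: le_trans (ltW Cy); exact: hC.
Qed.

(** The fundamental theorem of calculus on an interval containing the support *)
Lemma integral_derivative_csupp (M : R) (F f : R -> R) :
  (forall x : R, is_derive x 1 F (f x)) -> continuous f ->
  (forall x : R, M < `|x| -> F x = 0) ->
  (\int[lambda]_x (f x)%:E = 0)%E.
Proof.
move=> dF cf F0; pose N : R := `|M| + 1.
have N0 : 0 < N by rewrite ltr_wpDl.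
have MN : M < N by rewrite ltr_pwDr// ler_norm.
have f0 (x : R) : M < `|x| -> f x = 0.
  move=> Mx; have [_ <-] := dF x.
  have h : \forall y \near x, F y = cst 0 y.
    have : \forall y \near x, M < `|y|.
      have /= := @norm_continuous _ R x; move=> /cvgr_gt; exact.
    by apply: filterS => y; exact: F0.
  by rewrite (near_eq_derive _ h) derive_cst.
have dN : derivable_oo_LRcontinuous F (- N) N.
  have cF (x : R) : continuous_at x F.
    by apply/differentiable_continuous/derivable1_diffP; case: (dF x).
  by split=> [x _||]; [case: (dF x)|apply: cvg_at_right_filter; exact: cF|
    apply: cvg_at_left_filter; exact: cF].
have NN : - N < N by rewrite -subr_gt0 opprK addr_gt0.
transitivity (\int[lambda]_(x in `[(- N)%R, N]) (f x)%:E)%E.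
  rewrite [RHS]integral_mkcond; apply: eq_integral => x _.
  rewrite /patch; case: ifPn => // /negP xN; congr EFin; apply: f0.
  apply: lt_le_trans MN _; rewrite leNgt; apply/negP => Nx; apply: xN.
  by rewrite inE/= in_itv/= -ler_norml ltW.
rewrite (continuous_FTC2 NN _ dN).
- by rewrite !F0 ?normrN ?(ger0_norm (ltW N0))// -EFinB subrr.
- exact: continuous_subspaceT.
- by move=> x _; rewrite derive1E; case: (dF x).
Qed.

Lemma unit_vec0 : unit_vec 0 = (1, 0) :> R * R. Proof. by []. Qed.
Lemma unit_vec1 : unit_vec 1 = (0, 1) :> R * R. Proof. by []. Qed.

Lemma derive_fst f (a b : R) : derivable f (a, b) (unit_vec 0) ->
  is_derive a 1 (fun t => f (t, b)) ('D_(unit_vec 0) f (a, b)).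
Proof.
rewrite /derivable unit_vec0 => df.
have E : (fun h : R => h^-1 *: ((fun t => f (t, b)) (h *: 1 + a) - f (a, b))) =
  (fun h : R => h^-1 *: (f (h *: (1, 0) + (a, b)) - f (a, b))).
  apply/funext => h; congr (_ *: (f _ - _)).
  by rewrite [RHS]surjective_pairing /= scaler0 add0r.
by split; rewrite /derivable /derive /= E.
Qed.

Lemma derive_snd f (a b : R) : derivable f (a, b) (unit_vec 1) ->
  is_derive b 1 (fun t => f (a, t)) ('D_(unit_vec 1) f (a, b)).
Proof.
rewrite /derivable unit_vec1 => df.
have E : (fun h : R => h^-1 *: ((fun t => f (a, t)) (h *: 1 + b) - f (a, b))) =
  (fun h : R => h^-1 *: (f (h *: (0, 1) + (a, b)) - f (a, b))).
  apply/funext => h; congr (_ *: (f _ - _)).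
  by rewrite [RHS]surjective_pairing /= scaler0 add0r.
by split; rewrite /derivable /derive /= E.
Qed.

Lemma derive_vanish K f i : closed K -> (forall x, ~ K x -> f x = 0) ->
  forall x, ~ K x -> 'D_(unit_vec i) f x = 0.
Proof.
move=> cK f0 x Kx; have h : \forall y \near x, f y = cst 0 y.
  have : nbhs x (~` K) by apply: open_nbhs_nbhs; split => //; exact: closed_openC.
  by apply: filterS => y; exact: f0.
by rewrite (near_eq_derive _ h) derive_cst.
Qed.

Lemma ord2P (i : 'I_2) : i = 0 \/ i = 1.
Proof.
by case: i => [[|[|//]]] ?; [left|right]; exact/val_inj.
Qed.

Lemma closed_norm_le (M : R) : closed [set x : R * R | `|x| <= M].
Proof.
apply: (@preimage_closed _ _ (fun x : R * R => `|x|) [set y | y <= M]).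
  by apply: in1W => x; exact: norm_continuous.
exact: closed_le.
Qed.

(** By Fubini, the variable of differentiation may be integrated first. *)
Lemma integral_partial_csupp (M : R) f i :
  (forall x, derivable f x (unit_vec i)) -> continuous ('D_(unit_vec i) f) ->
  (forall x, M < `|x| -> f x = 0) ->
  \int[mu]_x 'D_(unit_vec i) f x = 0.
Proof.
move=> df cDf f0.
have Df0 x : M < `|x| -> 'D_(unit_vec i) f x = 0.
  move=> Mx; apply: (derive_vanish _ _ _ (closed_norm_le M)).
    by move=> y /= /negP; rewrite -ltNge; exact: f0.
  by apply/negP; rewrite -ltNge.
have intD := continuous_csupp_integrable M _ cDf Df0.
rewrite /Rintegral; case: (ord2P i) => ie; subst i.
- rewrite -(integral21_prod_meas1 intD)/=.
  rewrite integral0_eq// => b _.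
  apply: (@integral_derivative_csupp M (fun t => f (t, b))).
  + by move=> a; apply: derive_fst.
  + move=> a; apply: (@continuous_comp _ _ _ (fun a => (a, b)) ('D_(unit_vec 0) f));
      last exact: cDf.
    exact: (cvg_pair (@cvg_id _ (nbhs a)) (cvg_cst b)).
  + move=> a Ma; apply: f0; rewrite prod_normE/=.
    by apply: lt_le_trans Ma _; rewrite le_max lexx.
- rewrite -(integral12_prod_meas1 intD)/=.
  rewrite integral0_eq// => a _.
  apply: (@integral_derivative_csupp M (fun t => f (a, t))).
  + by move=> b; apply: derive_snd.
  + move=> b; apply: (@continuous_comp _ _ _ (fun b => (a, b)) ('D_(unit_vec 1) f));
      last exact: cDf.
    exact: (cvg_pair (cvg_cst a) (@cvg_id _ (nbhs b))).
  + move=> b Mb; apply: f0; rewrite prod_normE/=.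
    by apply: lt_le_trans Mb _; rewrite le_max lexx orbT.
Qed.

End IntegrationByParts.

(** * Weak derivatives of smooth functions *)

Section WeakDerivatives.
Context {R : realType}.
Implicit Types (U V K : set (R * R)) (f g h phi : R * R -> R) (x : R * R)
  (s : seq 'I_2).

Local Notation plane := (measurableTypeR R * measurableTypeR R)%type.
Local Notation mu := (@leb2 R).

Lemma smooth_derive f i : smooth f -> smooth ('D_(unit_vec i) f).
Proof.
move=> sf s; have E : partials s ('D_(unit_vec i) f) = partials (rcons s i) f.
  by rewrite /partials foldr_rcons.
by rewrite E; exact: sf.
Qed.

Lemma smooth_partials f s : smooth f -> smooth (partials s f).
Proof. by move=> sf; elim: s => //= i s; exact: smooth_derive. Qed.

Lemma smooth_continuous f : smooth f -> continuous f.
Proof. by move=> /(_ [::])[]. Qed.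

Lemma smooth_derivable f i x : smooth f -> derivable f x (unit_vec i).
Proof. by move=> /(_ [::])[_]; apply. Qed.

Lemma test_function_support {U phi} : test_function U phi ->
  exists K, [/\ closed K, K `<=` U, (exists M, K `<=` square M) &
    forall s x, ~ K x -> partials s phi x = 0].
Proof.
move=> [_ cK KU]; exists (closure [set x | phi x != 0]); split => //.
- exact: closed_closure.
- have [M [_ hM]] := compact_bounded cK; exists (M + 1) => x Kx.
  by apply/norm_square; apply: hM => //; rewrite ltrDl.
- elim=> [|i s ih] x Kx /=.
    by apply/eqP; apply: contra_notT Kx => phix; exact: subset_closure.
  apply: (derive_vanish _ _ _ _ ih) => //; exact: closed_closure.
Qed.

(** The integral of the derivative of the compactly supported product vanishes. *)
Lemma integral_ibp (M : R) f phi i : smooth f -> smooth phi ->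
  (forall x, M < `|x| -> phi x = 0) ->
  \int[mu]_x (f x * 'D_(unit_vec i) phi x) =
  - \int[mu]_x ('D_(unit_vec i) f x * phi x).
Proof.
move=> sf sp p0.
have sDf := smooth_derive _ i sf; have sDp := smooth_derive _ i sp.
have Dp0 x : M < `|x| -> 'D_(unit_vec i) phi x = 0.
  move=> Mx; apply: (derive_vanish _ _ _ (closed_norm_le M)).
    by move=> y /= /negP; rewrite -ltNge; exact: p0.
  by apply/negP; rewrite -ltNge.
have DE : 'D_(unit_vec i) (fun x => f x * phi x) =
    fun x => f x * 'D_(unit_vec i) phi x + 'D_(unit_vec i) f x * phi x.
  apply/funext => x; have df := smooth_derivable _ i x sf.
  have dp := smooth_derivable _ i x sp.
  by rewrite [LHS](deriveM df dp) /GRing.scale/= [phi x * _]mulrC.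
have cM g h : continuous g -> continuous h -> continuous (fun x => g x * h x).
  exact: continuous_mulr.
have c1 : continuous (fun x => f x * 'D_(unit_vec i) phi x).
  by apply: cM; exact: smooth_continuous.
have c2 : continuous (fun x => 'D_(unit_vec i) f x * phi x).
  by apply: cM; exact: smooth_continuous.
apply/eqP; rewrite -subr_eq0 opprK -RintegralD//.
- rewrite -[X in Rintegral _ _ X]DE; apply/eqP; apply: (integral_partial_csupp M).
  + by move=> x; apply: derivableM; exact: smooth_derivable.
  + rewrite DE => x; apply: cvgD; [exact: c1|exact: c2].
  + by move=> x /p0 ->; rewrite mulr0.
- apply: (continuous_csupp_integrable M) => //.
  by move=> x /Dp0 ->; rewrite mulr0.
- apply: (continuous_csupp_integrable M) => //.
  by move=> x /p0 ->; rewrite mulr0.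
Qed.

Lemma integral_ibp_partials (M : R) f phi s : smooth f -> smooth phi ->
  (forall s x, M < `|x| -> partials s phi x = 0) ->
  \int[mu]_x (f x * partials s phi x) =
  (- 1) ^+ size s * \int[mu]_x (partials (rev s) f x * phi x).
Proof.
move=> + sp p0; elim: s f => [|i s ih] f sf /=; first by rewrite expr0 mul1r.
rewrite (integral_ibp M)//; [|exact: smooth_partials|by move=> x; exact: p0].
rewrite ih; last exact: smooth_derive.
by rewrite rev_cons exprS mulN1r mulNr /partials foldr_rcons.
Qed.

(** The integrand vanishes off [U]. This is why restrictions of functions have
    the restricted weak derivatives. *)
Lemma test_integral {U V phi} f s : test_function U phi -> U `<=` V ->
  \int[mu]_(x in V) (f x * partials s phi x) =
  \int[mu]_(x in U) (f x * partials s phi x).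
Proof.
move=> /test_function_support[K [_ KU _ K0]] UV.
rewrite Rintegral_mkcond [RHS]Rintegral_mkcond; congr Rintegral.
apply/funext => x; rewrite /patch.
have [xU|xU] := boolP (x \in U); first by rewrite mem_set//; exact/UV/set_mem.
case: ifP => // _; rewrite K0 ?mulr0// => /KU Ux.
by move/negP: xU; apply; exact: mem_set.
Qed.

Lemma test_function_subset {U V phi} : test_function U phi -> U `<=` V ->
  test_function V phi.
Proof. by move=> [sp cp pU] UV; split => //; exact: subset_trans pU UV. Qed.

(** The derivatives of the test function are moved one at a time, the outermost
    first, hence the reversal. *)
Lemma smooth_weak_partial U f s : smooth f ->
  is_weak_partial U s f (partials (rev s) f).
Proof.
move=> sf phi tphi; have [K [_ KU [M KM] K0]] := test_function_support tphi.
have [sp _ _] := tphi.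
have := test_integral f s tphi (@subsetT _ U) => <-.
have := test_integral (partials (rev s) f) [::] tphi (@subsetT _ U) => /= <-.
apply: (integral_ibp_partials M) => // r x Mx; apply: K0.
by move=> /KM /norm_square; rewrite leNgt Mx.
Qed.

Lemma is_weak_partial_subset U V s f g : U `<=` V ->
  is_weak_partial V s f g -> is_weak_partial U s f g.
Proof.
move=> UV wfg phi tphi; have := wfg _ (test_function_subset tphi UV).
by rewrite (test_integral f s tphi UV) (test_integral g [::] tphi UV).
Qed.

Lemma test_L2 U phi s : measurable (U : set plane) -> test_function U phi ->
  L2 U (partials s phi).
Proof.
move=> mU tphi; have [K [_ KU [M KM] K0]] := test_function_support tphi.
have [sp _ _] := tphi; have cps := smooth_continuous _ (smooth_partials _ s sp).
have p0 x : M < `|x| -> partials s phi x = 0.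
  by move=> Mx; apply: K0 => /KM /norm_square; rewrite leNgt Mx.
have cp2 := continuous_mulr _ _ cps cps.
apply/(L2P mU); split.
  by apply: measurable_funTS; exact: continuous_measurable_plane.
apply: (integrableS measurableT mU) => //.
apply: (continuous_csupp_integrable M).
  by under eq_fun do rewrite expr2.
by move=> x /p0 ->; rewrite expr0n.
Qed.

End WeakDerivatives.

(** * Bump functions and vanishing integrals *)

Section Bump.
Context {R : realType}.

Lemma flat1_ge0 (y : R) : 0 <= flat 1 y.
Proof. by rewrite /flat; case: ifP => // _; rewrite hornerC mul1r expR_ge0. Qed.

Lemma flat1_le1 (y : R) : flat 1 y <= 1.
Proof.
rewrite /flat; case: ltP => // y0; rewrite hornerC mul1r -expR0 ler_expR.
by rewrite oppr_le0 invr_ge0 ltW.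
Qed.

Lemma flat1_neq0 (y : R) : (flat 1 y != 0) = (0 < y).
Proof.
rewrite /flat; case: ltP => y0; last by rewrite eqxx.
by rewrite hornerC mul1r gt_eqF// expR_gt0.
Qed.

Lemma flat1_cvg (y : R) : 0 < y -> flat 1 (n.+1%:R * y) @[n --> \oo] --> (1 : R).
Proof.
move=> y0.
have -> : (fun n => flat 1 (n.+1%:R * y)) = fun n => expR (- (y^-1 * n.+1%:R^-1)).
  apply/funext => n; rewrite /flat mulr_gt0// hornerC mul1r invfM.
  by rewrite [_^-1 * _]mulrC.
rewrite -[X in _ --> X]expR0; apply: continuous_cvg; first exact: continuous_expR.
rewrite -[X in _ --> X]oppr0; apply: cvgN.
rewrite -[X in _ --> X](mulr0 y^-1); apply: cvgM; first exact: cvg_cst.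
exact: cvg_harmonic.
Qed.

Variables a b c d : R.

(** [exp(-1/t)] tends to the indicator of the positive half line when [t] is
    scaled up, so these bumps, all supported in one closed rectangle, tend to
    the indicator of its interior. *)
Definition bump (n : nat) (x : R * R) : R :=
  (flat 1 (n.+1%:R * (x.1 - a)) * flat 1 (n.+1%:R * (b - x.1))) *
  (flat 1 (n.+1%:R * (x.2 - c)) * flat 1 (n.+1%:R * (d - x.2))).

Lemma bump_elementary n : elementary (bump n).
Proof.
have aff g u v : elementary g ->
    elementary (fun x : R * R => flat 1 (u * (g x + v))).
  move=> eg; apply/elementary_flat/elementaryM; first exact: elementary_cst.
  by apply: elementaryD => //; exact: elementary_cst.
have opp g u v : elementary g ->
    elementary (fun x : R * R => flat 1 (u * (v - g x))).
  move=> eg; have -> : (fun x => flat 1 (u * (v - g x))) =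
      fun x => flat 1 (- u * (g x + - v)).
    by apply/funext => x; congr (flat _ _); ring.
  exact: aff.
have e1 := elementary_fst; have e2 := elementary_snd.
apply: elementaryM; apply: elementaryM.
- exact: aff.
- exact: opp.
- exact: aff.
- exact: opp.
Qed.

Lemma bump_neq0 n x : (bump n x != 0) <-> rect a b c d x.
Proof.
rewrite /bump !mulf_eq0 !negb_or !flat1_neq0 !pmulr_rgt0// !subr_gt0.
rewrite /rect /= !in_itv/=; split.
  by move=> /andP[/andP[-> ->] /andP[-> ->]].
by move=> [/andP[-> ->] /andP[-> ->]].
Qed.

Lemma bump_norm_le1 n x : `|bump n x| <= 1.
Proof.
have h (s t : R) : 0 <= s -> s <= 1 -> 0 <= t -> t <= 1 -> s * t <= 1.
  by move=> s0 s1 t0 t1; rewrite -[1]mulr1 ler_pM.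
rewrite ger0_norm; last by rewrite /bump !mulr_ge0// flat1_ge0.
by rewrite /bump; apply: (h); rewrite ?mulr_ge0 ?flat1_ge0//; apply: h;
  rewrite ?flat1_ge0 ?flat1_le1.
Qed.

Lemma bump_cvg x : rect a b c d x -> bump n x @[n --> \oo] --> (1 : R).
Proof.
rewrite /rect /= !in_itv/= => -[/andP[h1 h2] /andP[h3 h4]].
rewrite -[X in _ --> X](mulr1 1).
apply: cvgM; rewrite -[X in _ --> X](mulr1 1).
  by apply: cvgM; apply: flat1_cvg; rewrite subr_gt0.
by apply: cvgM; apply: flat1_cvg; rewrite subr_gt0.
Qed.

Lemma bump_test U n : crect a b c d `<=` U ->
  test_function U (bump n).
Proof.
move=> rU; have cr : compact (crect a b c d).
  by apply: compact_setX; exact: segment_compact.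
have hR : hausdorff_space (R * R)%type by exact: norm_hausdorff.
have clr := compact_closed hR cr.
have sub : closure [set x | bump n x != 0] `<=` crect a b c d.
  have /closure_id -> := clr; apply: closure_subset.
  by move=> x /= /bump_neq0; exact: rect_subset.
split; last exact: subset_trans sub rU.
- exact/elementary_smooth/bump_elementary.
- exact: (subclosed_compact (@closed_closure _ _) cr sub).
Qed.

End Bump.

Section NullIntegrals.
Context d1 d2 {X : measurableType d1} {T : measurableType d2} {R : realType}.
Variables (mu : {measure set X -> \bar R}).

(** The sets whose preimages carry a vanishing integral form a Dynkin system, so
    it suffices to test them on generators. With a coordinate for [f], one
    coordinate of a rectangle is treated at a time. *)
Lemma null_integral_dynkin (D : set X) (h : X -> \bar R) (f : X -> T)
    (G : set (set T)) : measurable D -> mu.-integrable D h ->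
  measurable_fun setT f -> @measurable _ T = <<s G>> -> setI_closed G ->
  (\int[mu]_(x in D) h x = 0)%E ->
  (forall A, G A -> (\int[mu]_(x in D `&` f @^-1` A) h x = 0)%E) ->
  forall A, measurable A -> (\int[mu]_(x in D `&` f @^-1` A) h x = 0)%E.
Proof.
move=> mD ih mf mG GI D0 G0 A mA.
have mDf (S : set T) : measurable S -> measurable (D `&` f @^-1` S).
  by move=> mS; apply: measurableI => //; rewrite -[_ @^-1` _]setTI; exact: mf.
apply: (@dynkin_induction _ T G
  (fun S => (\int[mu]_(x in D `&` f @^-1` S) h x = 0)%E)) => //.
- by rewrite preimage_setT setIT.
- move=> S mS S0.
  have DE : D = (D `&` f @^-1` S) `|` (D `&` f @^-1` (~` S)).
    by rewrite -setIUr preimage_setC setUv setIT.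
  have := D0; rewrite {1}DE integral_setU//.
  + by rewrite S0 add0e.
  + exact: mDf.
  + by apply: mDf; exact: measurableC.
  + by rewrite -DE; exact: measurable_int ih.
  + apply/disj_setPS; rewrite preimage_setC => x [[_ h1] [_ h2]].
    by case: h2.
- move=> F mF tF F0; rewrite preimage_bigcup setI_bigcupr.
  rewrite integral_bigcup//.
  + by apply: eseries0 => i _ _; exact: F0.
  + apply: trivIset_setIl.
    apply/trivIsetP => /= i j _ _ ij; rewrite -preimage_setI.
    by move/trivIsetP : tF => /(_ _ _ _ _ ij) ->//; rewrite preimage_set0.
  + by move=> k; exact: mDf.
  + rewrite -setI_bigcupr; apply: (integrableS mD) ih => //.
    apply: measurableI => //; apply: bigcup_measurable => k _.
    by rewrite -[_ @^-1` _]setTI; exact: mf.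
- by rewrite -mG.
Qed.

End NullIntegrals.

(** * The fundamental lemma of the calculus of variations *)

Section FundamentalLemma.
Context {R : realType}.
Implicit Types (U : set (R * R)) (g : R * R -> R).

Local Notation plane := (measurableTypeR R * measurableTypeR R)%type.
Local Notation mu := (@leb2 R).

Lemma rect_lty a b c d : (mu (rect a b c d) < +oo)%E.
Proof.
rewrite leb2_rectangle//= !lebesgue_measure_itv/=.
by do 2!case: ifP => _; rewrite ?mule0 ?mul0e// -!EFinD -EFinM ltry.
Qed.

Lemma L2_rect_integrable U g a b c d : measurable (U : set plane) ->
  L2 U g -> rect a b c d `<=` U -> mu.-integrable (rect a b c d) (EFin \o g).
Proof.
move=> mU gL rU; have mr := measurable_rect a b c d.
have gr := L2_subset mU mr rU gL.
have oneL : L2 (rect a b c d) (cst 1).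
  apply: (bounded_L2 1) => //; first exact: rect_lty.
  by move=> x _; rewrite normr1.
have := L2_mul_integrable mr gr oneL; apply: eq_integrable => // x _ /=.
by rewrite mulr1.
Qed.

(** Dominated convergence, for bumps tending to the indicator *)
Lemma rect_integral0 U g a b c d : measurable (U : set plane) -> L2 U g ->
  crect a b c d `<=` U ->
  (forall phi, test_function U phi -> \int[mu]_(x in U) (g x * phi x) = 0) ->
  (\int[mu]_(x in rect a b c d) (g x)%:E = 0)%E.
Proof.
move=> mU gL cU g0; have mr := measurable_rect a b c d.
have rU : rect a b c d `<=` U by apply: subset_trans cU; exact: rect_subset.
have ig := L2_rect_integrable _ _ _ _ _ _ mU gL rU.
have mg : measurable_fun (rect a b c d : set plane) g.
  by have := measurable_int _ ig => /measurable_EFinP.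
pose gn n x := (g x * bump a b c d n x)%:E.
have mgn n : measurable_fun (rect a b c d : set plane) (gn n).
  apply/measurable_EFinP; apply: measurable_funM => //; apply: measurable_funTS.
  apply: continuous_measurable_plane.
  exact: (smooth_continuous _ (elementary_smooth _ (bump_elementary a b c d n))).
have int0 n : (\int[mu]_(x in rect a b c d) gn n x = 0)%E.
  have := g0 _ (bump_test a b c d _ n cU).
  rewrite Rintegral_mkcond => E.
  have rE : (fun x => g x * bump a b c d n x) \_ U =
            (fun x => g x * bump a b c d n x) \_ (rect a b c d).
    apply/funext => x; rewrite /patch.
    have [xr|xr] := boolP (x \in rect a b c d); first by
      rewrite mem_set//; exact/rU/set_mem.
    case: ifP => // _; apply/eqP; rewrite mulf_eq0; apply/orP; right.
    by apply: contraNT xr => /bump_neq0 xr; apply: mem_set.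
  move: E; rewrite rE -Rintegral_mkcond /Rintegral => E.
  have ign : mu.-integrable (rect a b c d) (gn n).
    apply: le_integrable ig => // x _ /=; rewrite lee_fin normrM.
    by rewrite ler_piMr// bump_norm_le1.
  by rewrite -[LHS]fineK ?E//; exact: integrable_fin_num.
have aeg : {ae mu, forall x, rect a b c d x -> gn n x @[n --> \oo] --> (EFin \o g) x}.
  apply: aeW => x rx; apply: cvg_EFin; first exact: nearW.
  rewrite /= -[X in _ --> X]mulr1; apply: cvgM; first exact: cvg_cst.
  exact: bump_cvg.
have aed : {ae mu, forall x n, rect a b c d x -> (`|gn n x| <= `|(g x)%:E|)%E}.
  by apply: aeW => x n _; rewrite lee_fin normrM ler_piMr// bump_norm_le1.
have [_ _] := @dominated_convergence _ plane R mu (rect a b c d) mr gn (EFin \o g)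
  (fun x => `|(g x)%:E|)%E mgn (measurable_int _ ig) aeg (integrable_abse ig) aed.
rewrite (_ : [sequence _]_n = cst 0%E); last by apply/funext => n; exact: int0.
move=> h; apply/esym.
exact: (@cvg_unique _ (@ereal_hausdorff R) _ _ _ _ (cvg_cst _) h).
Qed.

Definition open_itvs : set (set R) := [set A | exists x y, A = `]x, y[%classic].

Lemma open_itvs_setI : setI_closed open_itvs.
Proof.
move=> _ _ [a [b ->]] [c [d ->]]; exists (Num.max a c), (Num.min b d).
apply/seteqP; split => x; rewrite /= !in_itv/= gt_max lt_min.
  by move=> [/andP[-> ->] /andP[-> ->]].
by move=> /andP[/andP[-> ->] /andP[-> ->]].
Qed.

Lemma open_itvs_measurable : @measurable _ (measurableTypeR R) = <<s open_itvs >>.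
Proof. exact: (RGenOpens.measurableE R). Qed.

(** From open subrectangles to products of measurable sets, one factor after the
    other, and then to all measurable sets of the plane *)
Lemma rect_ae0 U g a b c d : measurable (U : set plane) -> L2 U g ->
  crect a b c d `<=` U ->
  (forall phi, test_function U phi -> \int[mu]_(x in U) (g x * phi x) = 0) ->
  g = cst 0 %[ae mu in rect a b c d].
Proof.
move=> mU gL cU g0; have mr := measurable_rect a b c d.
have rU : rect a b c d `<=` U by apply: subset_trans cU; exact: rect_subset.
have ig := L2_rect_integrable _ _ _ _ _ _ mU gL rU.
have mfst : measurable_fun setT (fst : plane -> measurableTypeR R).
  exact: measurable_fst.
have msnd : measurable_fun setT (snd : plane -> measurableTypeR R).
  exact: measurable_snd.
have sub0 (p q r s : R) : (\int[mu]_(x in rect a b c d `&`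
    (snd @^-1` `]r, s[%classic) `&` fst @^-1` `]p, q[%classic) (g x)%:E = 0)%E.
  have -> : rect a b c d `&` (snd @^-1` `]r, s[%classic) `&` fst @^-1` `]p, q[%classic =
      rect (Num.max a p) (Num.min b q) (Num.max c r) (Num.min d s).
    apply/seteqP; split => x; rewrite /rect /= !in_itv/= !gt_max !lt_min.
      by move=> [[[/andP[-> ->] /andP[-> ->]] /andP[-> ->]] /andP[-> ->]].
    by move=> [/andP[/andP[-> ->] /andP[-> ->]] /andP[/andP[-> ->] /andP[-> ->]]].
  apply: (rect_integral0 U) => // x [].
  rewrite /= !in_itv/= !ge_max !le_min => /andP[/andP[h1 _] /andP[h2 _]].
  move=> /andP[/andP[h3 _] /andP[h4 _]]; apply: cU.
  by split; rewrite /= in_itv/= ?h1 ?h2 ?h3 ?h4.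
have full : rect a b c d `&` snd @^-1` `]c, d[%classic `&` fst @^-1` `]a, b[%classic
    = rect a b c d.
  by apply/seteqP; split => [x [[]]//|x []]; split.
have full1 r s : rect a b c d `&` snd @^-1` `]r, s[%classic `&` fst @^-1` `]a, b[%classic
    = rect a b c d `&` snd @^-1` `]r, s[%classic.
  by apply/seteqP; split => [x [[]]//|x [[? ?] ?]]; split.
have m2 S : measurable (S : set (measurableTypeR R)) ->
    measurable (rect a b c d `&` snd @^-1` S : set plane).
  by move=> mS; apply: measurableI => //; rewrite -[_ @^-1` _]setTI; exact: msnd.
have m1 S : measurable (S : set (measurableTypeR R)) ->
    measurable (rect a b c d `&` fst @^-1` S : set plane).
  by move=> mS; apply: measurableI => //; rewrite -[_ @^-1` _]setTI; exact: mfst.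
have st1 r s A : measurable (A : set (measurableTypeR R)) ->
    (\int[mu]_(x in rect a b c d `&` snd @^-1` `]r, s[%classic `&` fst @^-1` A)
      (g x)%:E = 0)%E.
  apply: (@null_integral_dynkin _ _ plane (measurableTypeR R) R mu _ (EFin \o g)
    fst open_itvs) => //.
  - by apply: m2; exact: measurable_itv.
  - by apply: (integrableS mr) ig => //; apply: m2; exact: measurable_itv.
  - exact: open_itvs_measurable.
  - exact: open_itvs_setI.
  - by rewrite -full1; exact: sub0.
  - by move=> _ [p [q ->]]; exact: sub0.
have st2 A B : measurable (A : set (measurableTypeR R)) ->
    measurable (B : set (measurableTypeR R)) ->
    (\int[mu]_(x in rect a b c d `&` fst @^-1` A `&` snd @^-1` B) (g x)%:E = 0)%E.
  move=> mA; apply: (@null_integral_dynkin _ _ plane (measurableTypeR R) R mu _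
    (EFin \o g) snd open_itvs) => //.
  - exact: m1.
  - by apply: (integrableS mr) ig => //; exact: m1.
  - exact: open_itvs_measurable.
  - exact: open_itvs_setI.
  - have <- : rect a b c d `&` snd @^-1` `]c, d[%classic `&` fst @^-1` A =
        rect a b c d `&` fst @^-1` A.
      by apply/seteqP; split => [x [[]]//|x [[? ?] ?]]; split.
    exact: st1.
  - by move=> _ [p [q ->]]; rewrite setIAC; exact: st1.
have st3 S : measurable (S : set plane) ->
    (\int[mu]_(x in rect a b c d `&` S) (g x)%:E = 0)%E.
  apply: (@null_integral_dynkin _ _ plane plane R mu _ (EFin \o g) id
    [set A `*` B | A in @measurable _ (measurableTypeR R) &
                   B in @measurable _ (measurableTypeR R)]) => //.
  - exact: measurable_prod_measurableType.
  - move=> _ _ [A mA [B mB <-]] [A' mA' [B' mB' <-]].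
    exists (A `&` A'); first exact: measurableI.
    by exists (B `&` B'); [exact: measurableI|rewrite setXI].
  - by rewrite -full; exact: sub0.
  - move=> _ [A mA [B mB <-]]; rewrite (_ : _ `&` _ =
        rect a b c d `&` fst @^-1` A `&` snd @^-1` B).
      exact: st2.
    by rewrite -setIA.
have := @integral_ae_eq _ plane R mu (rect a b c d) mr (cst 0%E) (EFin \o g) ig.
have m0 : measurable_fun (rect a b c d : set plane) (cst 0%E : plane -> \bar R).
  exact: measurable_cst.
move=> /(_ m0); set P := (X in (X -> _) -> _) => h.
have {h} : P -> g = cst 0 %[ae mu in rect a b c d].
  by move=> /h; apply: leb2_aeS => x + rx => /(_ rx) [->].
apply; move=> S Sr mS; rewrite integral0.
by have := st3 _ mS; rewrite setIidr.
Qed.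

(** The bumps supported in [U] already determine a function locally. *)
Lemma fundamental_lemma U g : open U -> L2 U g ->
  (forall phi, test_function U phi -> \int[mu]_(x in U) (g x * phi x) = 0) ->
  g = cst 0 %[ae mu in U].
Proof.
move=> oU gL g0; have mU := open_measurable_plane _ oU.
have [a [b [c [d [sub cov]]]]] := open_rectangle_cover _ oU.
have ae n : \forall x \ae mu, rect (a n) (b n) (c n) (d n) x -> g x = 0.
  exact: (rect_ae0 _ _ _ _ _ _ mU gL (sub n) g0).
have := @ae_foralln _ plane R mu _ ae; apply: leb2_aeS => x h Ux.
by have [n _ rx] := cov _ Ux; exact: (h n).
Qed.

End FundamentalLemma.

(** * Uniqueness and linearity of weak derivatives *)

Section SobolevForms.
Context {R : realType}.
Implicit Types (U V : set (R * R)) (f g h v w phi : R * R -> R) (s : seq 'I_2)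
  (m k : nat).

Local Notation plane := (measurableTypeR R * measurableTypeR R)%type.
Local Notation mu := (@leb2 R).

Lemma weak_partial_L2 U s f : measurable (U : set plane) ->
  L2 U (weak_partial U s f).
Proof.
move=> mU; rewrite /weak_partial.
by case: xgetP => [g _ []|_] //; exact: L2_0.
Qed.

Lemma weak_partialP U s f :
  (exists2 g, L2 U g & is_weak_partial U s f g) ->
  is_weak_partial U s f (weak_partial U s f).
Proof.
move=> [g gL wg]; rewrite /weak_partial.
by case: xgetP => [g' _ []//|] /(_ g) [].
Qed.

Lemma integral_test_linear U f g phi s (a : R) : measurable (U : set plane) ->
  L2 U f -> L2 U g -> test_function U phi ->
  \int[mu]_(x in U) ((a * f x + g x) * partials s phi x) =
  a * \int[mu]_(x in U) (f x * partials s phi x) +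
  \int[mu]_(x in U) (g x * partials s phi x).
Proof.
by move=> mU fL gL tphi; apply: ip_linear => //; exact: test_L2.
Qed.

Lemma is_weak_partial_linear U s f f' g g' (a : R) :
  measurable (U : set plane) -> L2 U f -> L2 U f' -> L2 U g -> L2 U g' ->
  is_weak_partial U s f g -> is_weak_partial U s f' g' ->
  is_weak_partial U s (fun x => a * f x + f' x) (fun x => a * g x + g' x).
Proof.
move=> mU fL f'L gL g'L wg wg' phi tphi.
rewrite integral_test_linear// wg// wg'//.
have := integral_test_linear U g g' phi [::] a mU gL g'L tphi => /= ->.
ring.
Qed.

Lemma is_weak_partial_ae U s f f' g : measurable (U : set plane) ->
  L2 U f -> L2 U f' -> f = f' %[ae mu in U] ->
  is_weak_partial U s f g -> is_weak_partial U s f' g.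
Proof.
move=> mU fL f'L ff' wg phi tphi; rewrite -(wg _ tphi).
have pL := test_L2 U phi s mU tphi.
by apply/esym; apply: ae_ip => //; apply: aeW.
Qed.

(** The difference of two weak derivatives integrates to zero against every test
    function. The chosen representative [weak_partial] therefore depends on the
    function linearly, almost everywhere. *)
Lemma is_weak_partial_unique U s f g g' : open U -> L2 U g -> L2 U g' ->
  is_weak_partial U s f g -> is_weak_partial U s f g' -> g = g' %[ae mu in U].
Proof.
move=> oU gL g'L wg wg'; have mU := open_measurable_plane _ oU.
have dL := L2_linear (- 1) mU g'L gL.
have : (fun x => - 1 * g' x + g x) = cst 0 %[ae mu in U].
  apply: fundamental_lemma => // phi tphi.
  rewrite (integral_test_linear U g' g phi [::])//=.
  have := wg _ tphi; rewrite (wg' _ tphi) => /(congr1 (fun x => (-1) ^+ size s * x)).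
  by rewrite !mulrA -expr2 sqrr_sign !mul1r => ->; rewrite mulN1r addNr.
by apply: leb2_aeS => x + Ux => /(_ Ux) /=; rewrite mulN1r addrC => /subr0_eq.
Qed.

Lemma weak_partial_ae U s f f' : measurable (U : set plane) ->
  L2 U f -> L2 U f' -> f = f' %[ae mu in U] ->
  weak_partial U s f = weak_partial U s f'.
Proof.
move=> mU fL f'L ff'; rewrite /weak_partial; congr (xget _ _).
have f'f : f' = f %[ae mu in U] by apply: leb2_aeS ff' => x + Ux => ->.
by apply/seteqP; split => g [gL wg]; split => //;
  apply: is_weak_partial_ae wg.
Qed.

Lemma weak_partialE U s f g : open U -> L2 U g -> is_weak_partial U s f g ->
  weak_partial U s f = g %[ae mu in U].
Proof.
move=> oU gL wg; have mU := open_measurable_plane _ oU.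
apply: (is_weak_partial_unique _ s f) => //; first exact: weak_partial_L2.
by apply: weak_partialP; exists g.
Qed.

Lemma weak_partial_linear U m s f g (a : R) : open U -> (size s <= m)%N ->
  Hm U m f -> Hm U m g ->
  weak_partial U s (fun x => a * f x + g x) =
  (fun x => a * weak_partial U s f x + weak_partial U s g x) %[ae mu in U].
Proof.
move=> oU sm [fL fH] [gL gH]; have mU := open_measurable_plane _ oU.
apply: weak_partialE => //.
  by apply: L2_linear => //; exact: weak_partial_L2.
apply: is_weak_partial_linear => //; try exact: weak_partial_L2.
- by apply: weak_partialP; exact: fH.
- by apply: weak_partialP; exact: gH.
Qed.

Lemma Hm_linear U m f g (a : R) : open U -> Hm U m f -> Hm U m g ->
  Hm U m (fun x => a * f x + g x).
Proof.
move=> oU [fL fH] [gL gH]; have mU := open_measurable_plane _ oU.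
split; first exact: L2_linear.
move=> s sm; have [f' f'L wf] := fH _ sm; have [g' g'L wg] := gH _ sm.
exists (fun x => a * f' x + g' x); first exact: L2_linear.
exact: is_weak_partial_linear.
Qed.

Lemma Hm_ae U m f g : open U -> Hm U m f -> L2 U g -> f = g %[ae mu in U] ->
  Hm U m g.
Proof.
move=> oU [fL fH] gL fg; have mU := open_measurable_plane _ oU.
split=> // s sm; have [f' f'L wf] := fH _ sm; exists f' => //.
exact: is_weak_partial_ae wf.
Qed.

Lemma Hm_subset U V m f : open U -> open V -> U `<=` V -> Hm V m f -> Hm U m f.
Proof.
move=> oU oV UV [fL fH].
have mU := open_measurable_plane _ oU; have mV := open_measurable_plane _ oV.
split; first exact: L2_subset fL.
move=> s sm; have [f' f'L wf] := fH _ sm; exists f'; first exact: L2_subset f'L.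
exact: is_weak_partial_subset wf.
Qed.

Lemma weak_partial_subset U V m s f : open U -> open V -> U `<=` V ->
  (size s <= m)%N -> Hm V m f ->
  weak_partial U s f = weak_partial V s f %[ae mu in U].
Proof.
move=> oU oV UV sm [fL fH].
have mU := open_measurable_plane _ oU; have mV := open_measurable_plane _ oV.
apply: weak_partialE => //; first by apply: (L2_subset mV mU UV); exact: weak_partial_L2.
by apply: (is_weak_partial_subset U V) => //; apply: weak_partialP; exact: fH.
Qed.

Lemma smooth_Hm U m f : smooth f -> (forall s, L2 U (partials s f)) -> Hm U m f.
Proof.
move=> sf fL; split; first exact: (fL [::]).
move=> s _; exists (partials (rev s) f); first exact: fL.
exact: smooth_weak_partial.
Qed.

Lemma smooth_weak_partialE U s f : open U -> smooth f ->
  (forall s, L2 U (partials s f)) ->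
  weak_partial U s f = partials (rev s) f %[ae mu in U].
Proof.
by move=> oU sf fL; apply: weak_partialE => //; exact: smooth_weak_partial.
Qed.

Lemma test_Hm U m phi : open U -> test_function U phi -> Hm U m phi.
Proof.
move=> oU tphi; have mU := open_measurable_plane _ oU.
by apply: smooth_Hm => [|s]; [case: tphi|exact: test_L2].
Qed.

Lemma dotDE U k v w : open U ->
  dotD U k v w =
  \sum_(s : k.-tuple 'I_2) ip U (weak_partial U s v) (weak_partial U s w).
Proof.
move=> oU; have mU := open_measurable_plane _ oU.
rewrite /dotD /Rintegral; under eq_integral do rewrite -sumEFin.
have int (s : k.-tuple 'I_2) : mu.-integrable U
    (fun x => (weak_partial U s v x * weak_partial U s w x)%:E).
  by apply: (L2_mul_integrable mU); exact: weak_partial_L2.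
rewrite integral_sum// -sum_fine// => s _.
by apply: integrable_fin_num.
Qed.

Lemma dotD_ae U k v v' w : open U -> L2 U v -> L2 U v' ->
  v = v' %[ae mu in U] -> dotD U k v w = dotD U k v' w.
Proof.
move=> oU vL v'L vv'; have mU := open_measurable_plane _ oU.
rewrite !(dotDE _ _ _ _ oU); apply: eq_bigr => s _.
by rewrite (weak_partial_ae U s v v').
Qed.

Lemma dotDC U k v w : open U -> dotD U k v w = dotD U k w v.
Proof. by move=> oU; rewrite !(dotDE _ _ _ _ oU); apply: eq_bigr => s _; exact: ipC. Qed.

Lemma dotD_ge0 U k v : open U -> 0 <= dotD U k v v.
Proof. by move=> oU; rewrite (dotDE _ _ _ _ oU); apply: sumr_ge0 => s _; exact: ip_ge0. Qed.

Lemma dotD_linear U m k u v w (a : R) : open U -> (k <= m)%N ->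
  Hm U m u -> Hm U m v ->
  dotD U k (fun x => a * u x + v x) w = a * dotD U k u w + dotD U k v w.
Proof.
move=> oU km uH vH; have mU := open_measurable_plane _ oU.
rewrite !(dotDE _ _ _ _ oU) mulr_sumr -big_split/=; apply: eq_bigr => s _.
have wL r f := weak_partial_L2 U r f mU.
rewrite -(ip_linear a mU)//; apply: (ae_ip mU) => //.
- exact: L2_linear.
- by apply: (weak_partial_linear _ m) => //; rewrite size_tuple.
- exact: aeW.
Qed.

End SobolevForms.

(** * Domains with Lipschitz boundary *)

Section Geometry.
Context {R : realType}.
Implicit Types (U D : set (R * R)) (x : R * R) (t : 'I_3 -> R * R).

Local Notation plane := (measurableTypeR R * measurableTypeR R)%type.
Local Notation mu := (@leb2 R).

(** A domain with Lipschitz boundary lies on one side of its boundary: arbitrarily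
    close to a boundary point there are points off the closure. *)
Lemma lipschitz_closure_interior U D : lipschitz_boundary D -> open D -> open U ->
  U `<=` closure D -> U `<=` D.
Proof.
move=> lipD oD oU UD p Up; apply: contrapT => nDp.
have bp : bdry D p by split; [exact: UD|move=> /interior_subset].
have [c [s [r [L [gamma [cs r0 lipg chart]]]]]] := lipD _ bp.
have edist_le (y z : R * R) : Defs.edist y z <= `|y.1 - z.1| + `|y.2 - z.2|.
  have h0 : 0 <= `|y.1 - z.1| + `|y.2 - z.2| by rewrite addr_ge0.
  rewrite /Defs.edist -[leRHS](ger0_norm h0) -[leRHS]sqrtr_sqr ler_sqrt ?sqr_ge0//.
  rewrite -(real_normK (num_real (y.1 - z.1))) -(real_normK (num_real (y.2 - z.2))).
  by rewrite sqrrD lerD2r lerDl mulrn_wge0// mulr_ge0.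
have c1 : `|c| <= 1.
  by rewrite -sqrtr_sqr -sqrtr1 ler_sqrt// -cs lerDl sqr_ge0.
have s1 : `|s| <= 1.
  by rewrite -sqrtr_sqr -sqrtr1 ler_sqrt// -cs lerDr sqr_ge0.
have etap : - s * p.1 + c * p.2 <= gamma (c * p.1 + s * p.2).
  rewrite leNgt; apply/negP => h; apply: nDp; apply/chart => //.
  by rewrite /Defs.edist !subrr expr0n addr0 sqrtr0.
have /nbhs_ballP[e /= e0 peU] : nbhs p U by exact: open_nbhs_nbhs.
pose k := 2 * (1 + `|L|) + 1.
have k1 : 1 < k by rewrite ltrDr mulr_gt0// ltr_pwDl.
have k0 : 0 < k by exact: lt_trans k1.
(* the point at depth [t] below the boundary, and the precision needed there *)
pose t := Num.min (r / 8) (e / 2).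
have t0 : 0 < t by rewrite lt_min !divr_gt0.
have tr : t <= r / 8 by rewrite ge_min lexx.
have te : t <= e / 2 by rewrite ge_min lexx orbT.
pose y : R * R := (p.1 + t * s, p.2 - t * c).
have py1 : `|p.1 - y.1| <= t.
  by rewrite /= opprD addNKr normrN normrM (gtr0_norm t0) ler_piMr// ltW.
have py2 : `|p.2 - y.2| <= t.
  by rewrite /= opprB addrC subrK normrM (gtr0_norm t0) ler_piMr// ltW.
have Uy : U y.
  apply: peU; split; rewrite /ball /=.
    by apply: le_lt_trans py1 _; apply: le_lt_trans te _; rewrite gtr_pMr// invf_lt1// ltr1n.
  by apply: le_lt_trans py2 _; apply: le_lt_trans te _; rewrite gtr_pMr// invf_lt1// ltr1n.
pose d := t / k.
have d0 : 0 < d by rewrite divr_gt0.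
have dt : d <= t by rewrite ler_pdivrMr// ler_peMr// ltW.
have [x [Dx [yx1 yx2]]] : exists x, D x /\ ball y d x.
  by have [x [? ?]] := UD _ Uy _ (nbhsx_ballx y _ d0); exists x.
move: yx1 yx2; rewrite /ball /= => yx1 yx2.
have px : Defs.edist p x < r.
  apply: le_lt_trans (edist_le _ _) _.
  have h1 : `|p.1 - x.1| <= t + d.
    by rewrite -(subrKA y.1) (le_trans (ler_normD _ _))// lerD// ltW.
  have h2 : `|p.2 - x.2| <= t + d.
    by rewrite -(subrKA y.2) (le_trans (ler_normD _ _))// lerD// ltW.
  move: h1 h2 r0 tr dt; lra.
have /chart := Dx => /(_ px); apply/negP; rewrite -leNgt.
have lin (a b u v : R) : `|a| <= 1 -> `|b| <= 1 -> `|u| <= d -> `|v| <= d ->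
    `|a * u + b * v| <= 2 * d.
  move=> a1 b1 ud vd; rewrite (le_trans (ler_normD _ _))// !normrM.
  rewrite mulr_natl mulr2n lerD// -[leRHS]mul1r ler_pM//.
have xi : `|(c * y.1 + s * y.2) - (c * x.1 + s * x.2)| <= 2 * d.
  rewrite (_ : _ - _ = c * (y.1 - x.1) + s * (y.2 - x.2)); last by ring.
  by apply: lin => //; exact: ltW.
have eta : `|(- s * y.1 + c * y.2) - (- s * x.1 + c * x.2)| <= 2 * d.
  rewrite (_ : _ - _ = - s * (y.1 - x.1) + c * (y.2 - x.2)); last by ring.
  by apply: lin; rewrite ?normrN//; exact: ltW.
have xiy : c * y.1 + s * y.2 = c * p.1 + s * p.2 by rewrite /y /=; ring.
have etay : - s * y.1 + c * y.2 = - s * p.1 + c * p.2 - t.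
  have -> : t = t * (c ^+ 2 + s ^+ 2) by rewrite cs mulr1.
  by rewrite /y /=; ring.
have lipx : `|gamma (c * y.1 + s * y.2) - gamma (c * x.1 + s * x.2)| <= `|L| * (2 * d).
  have /= := lipg (c * y.1 + s * y.2, c * x.1 + s * x.2) (conj I I).
  move=> h; apply: le_trans h _;
  apply: (@le_trans _ _ (`|L| * `|(c * y.1 + s * y.2) - (c * x.1 + s * x.2)|)).
    by rewrite ler_wpM2r// ler_norm.
  by rewrite ler_wpM2l.
have dk : d * k = t by rewrite divfK// gt_eqF.
move: lipx eta; rewrite xiy etay !ler_norml => /andP[_ l1] /andP[l2 _].
by move: dk; rewrite /k => dk; nra.
Qed.

End Geometry.

(** * Barycentric coordinates *)

Section Barycentric.
Context {R : realType}.
Implicit Types (x : R * R) (t : 'I_3 -> R * R) (S : {set 'I_3}).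

Local Notation plane := (measurableTypeR R * measurableTypeR R)%type.
Local Notation mu := (@leb2 R).

Lemma sum_ord3 (V : nmodType) (F : 'I_3 -> V) :
  \sum_k F k = F (inord 0) + F (inord 1) + F (inord 2).
Proof.
rewrite !big_ord_recr big_ord0/= add0r.
by congr (F _ + F _ + F _); apply/val_inj; rewrite /= inordK.
Qed.

Lemma ord3P (k : 'I_3) : [\/ k = inord 0, k = inord 1 | k = inord 2].
Proof.
case: k => [[|[|[|//]]]] ?; [apply: Or31|apply: Or32|apply: Or33];
  by apply/val_inj; rewrite /= inordK.
Qed.

(** Barycentric coordinates, by Cramer's rule *)
Definition bary t (k : 'I_3) x : R :=
  let p := t (inord 1) - t (inord 0) in let q := t (inord 2) - t (inord 0) in
  let r := x - t (inord 0) in let d := p.1 * q.2 - p.2 * q.1 in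
  let l1 := (r.1 * q.2 - r.2 * q.1) / d in
  let l2 := (p.1 * r.2 - p.2 * r.1) / d in
  if val k is n.+1 then (if n is 0 then l1 else l2) else 1 - l1 - l2.

Lemma bary_sum1 t x : \sum_k bary t k x = 1.
Proof. by rewrite sum_ord3 /bary /= !inordK//=; ring. Qed.

Lemma bary_combination t x : Defs.nondegenerate t -> x = \sum_k bary t k x *: t k.
Proof.
move=> ndt; rewrite sum_ord3 /bary /= !inordK//=.
move: ndt; rewrite /Defs.nondegenerate.
case: (t (inord 0)) (t (inord 1)) (t (inord 2)) x => [a1 a2] [b1 b2] [c1 c2] [x1 x2] /=.
move=> d0; congr pair; rewrite /= /GRing.scale/=; by field.
Qed.

Lemma bary_unique t x (l : 'I_3 -> R) : Defs.nondegenerate t -> \sum_k l k = 1 ->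
  x = \sum_k l k *: t k -> forall k, bary t k x = l k.
Proof.
move=> ndt; rewrite !sum_ord3 => l1 xE.
have l0 : l (inord 0) = 1 - l (inord 1) - l (inord 2) by rewrite -l1; ring.
have key : [/\ bary t (inord 0) x = l (inord 0), bary t (inord 1) x = l (inord 1) &
    bary t (inord 2) x = l (inord 2)].
  move: xE ndt; rewrite /bary /= !inordK//= l0 /Defs.nondegenerate.
  case: (t (inord 0)) (t (inord 1)) (t (inord 2)) x => [a1 a2] [b1 b2] [c1 c2] [x1 x2] /=.
  rewrite /GRing.scale/= => -[-> ->] d0; split; rewrite /GRing.scale/=; by field.
by move=> k; case: key; case: (ord3P k) => ->.
Qed.

Lemma faceP t S x : Defs.nondegenerate t ->
  face t S x <-> (forall k, 0 <= bary t k x) /\ forall k, k \notin S -> bary t k x = 0.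
Proof.
move=> ndt; split=> [[l [l0 lS l1 xE]]|[b0 bS]].
  have b := bary_unique _ _ _ ndt l1 xE.
  by split=> k => [|kS]; rewrite b//; exact: lS.
exists (bary t ^~ x); split => //; first exact: bary_sum1.
exact: bary_combination.
Qed.

Lemma bary_affine t k : Defs.nondegenerate t -> exists a b c : R,
  (b != 0) || (c != 0) /\ forall x, bary t k x = a + b * x.1 + c * x.2.
Proof.
rewrite /Defs.nondegenerate; set t0 := t (inord 0).
set p := t (inord 1) - t0; set q := t (inord 2) - t0 => /=.
have [d dE] : exists d, d = p.1 * q.2 - p.2 * q.1 by eexists.
rewrite -dE => d0.
have nz (b c : R) : (b = 0 -> c = 0 -> d = 0) -> (b / d != 0) || (c / d != 0).
  move=> h; rewrite -negb_and; apply/negP => /andP[].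
  rewrite !mulf_eq0 invr_eq0 (negbTE d0) !orbF => /eqP b0 /eqP c0.
  by move: d0; rewrite h ?eqxx.
have subE (u v : R * R) : ((u - v).1 = u.1 - v.1) * ((u - v).2 = u.2 - v.2) by [].
have [->|->|->] := ord3P k; rewrite /bary /= inordK//= -/t0 -/p -/q -dE.
- exists (1 + (t0.1 * (q.2 - p.2) - t0.2 * (q.1 - p.1)) / d), ((p.2 - q.2) / d),
    ((q.1 - p.1) / d).
  split=> [|x]; last by rewrite !subE; field.
  apply: nz => /subr0_eq h1 /subr0_eq h2; rewrite dE.
  by rewrite h1 h2; ring.
- exists ((t0.2 * q.1 - t0.1 * q.2) / d), (q.2 / d), (- q.1 / d).
  split=> [|x]; last by rewrite !subE; field.
  by apply: nz; rewrite dE => -> /eqP; rewrite oppr_eq0 => /eqP ->; ring.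
- exists ((p.2 * t0.1 - p.1 * t0.2) / d), (- p.2 / d), (p.1 / d).
  split=> [|x]; last by rewrite !subE; field.
  by apply: nz; rewrite dE => /eqP; rewrite oppr_eq0 => /eqP -> ->; ring.
Qed.

Lemma affine_continuous (a b c : R) :
  continuous (fun x : R * R => a + b * x.1 + c * x.2).
Proof.
move=> x; apply: cvgD.
  apply: cvgD; first exact: cvg_cst.
  by apply: cvgM; [exact: cvg_cst|exact: cvg_fst].
by apply: cvgM; [exact: cvg_cst|exact: cvg_snd].
Qed.

Lemma bary_continuous t k : Defs.nondegenerate t -> continuous (bary t k).
Proof.
move=> /(bary_affine t k)[a [b [c [_ E]]]].
by rewrite (_ : bary t k = fun x => a + b * x.1 + c * x.2);
  [exact: affine_continuous|apply/funext].
Qed.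

(** A line has a one-point section over each abscissa, unless it is vertical and
    thus the product of a point and the real line. *)
Lemma line_null (a b c : R) : (b != 0) || (c != 0) ->
  mu [set x | a + b * x.1 + c * x.2 = 0] = 0%E.
Proof.
move=> bc; set A := [set x | _].
have mA : measurable (A : set plane).
  apply: closed_measurable_plane.
  apply: (@preimage_closed _ _ (fun x : R * R => a + b * x.1 + c * x.2) [set 0]).
    by apply: in1W; exact: affine_continuous.
  exact: closed_eq.
have [c0|c0] := eqVneq c 0.
  have b0 : b != 0 by move: bc; rewrite c0 eqxx orbF.
  have -> : A = [set - a / b] `*` setT.
    apply/seteqP; split=> x; rewrite /A /= c0 mul0r addr0.
      move=> h; split => //; apply: (mulIf b0); rewrite divfK// mulrC.
      by apply/eqP; rewrite -subr_eq0 opprK addrC h.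
    by move=> [-> _]; rewrite mulrC divfK// addrN.
  rewrite leb2_rectangle//=.
  by rewrite lebesgue_measure_set1 mul0e.
rewrite /leb2 /= /product_measure1/=; apply: integral0_eq => u _ /=.
rewrite (_ : xsection A u = [set - (a + b * u) / c]) ?lebesgue_measure_set1//.
apply/seteqP; split=> v; rewrite /xsection/= inE /A/=.
  move=> h; apply: (mulIf c0); rewrite divfK// mulrC; apply/eqP.
  by rewrite -subr_eq0 opprK addrC h.
by move=> ->; rewrite [c * _]mulrC divfK// addrN.
Qed.

Lemma bary_ae_neq0 t k : Defs.nondegenerate t -> \forall x \ae mu, bary t k x != 0.
Proof.
move=> ndt; have [a [b [c [bc E]]]] := bary_affine t k ndt.
exists [set x | a + b * x.1 + c * x.2 = 0]; split; last first.
- by move=> x /= /negP; rewrite negbK E => /eqP.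
- exact: line_null.
apply: closed_measurable_plane.
apply: (@preimage_closed _ _ (fun x : R * R => a + b * x.1 + c * x.2) [set 0]).
  by apply: in1W; exact: affine_continuous.
exact: closed_eq.
Qed.

Lemma triangle_interior t x : Defs.nondegenerate t -> (forall k, 0 < bary t k x) ->
  (triangle t)° x.
Proof.
move=> ndt b0.
have oA : open (\bigcap_k [set x | 0 < bary t k x]).
  have -> : \bigcap_k [set x | 0 < bary t k x] = [set x | 0 < bary t (inord 0) x] `&`
      [set x | 0 < bary t (inord 1) x] `&` [set x | 0 < bary t (inord 2) x].
    apply/seteqP; split => [y h|y [[h0 h1] h2] k _]; first by split; [split|]; exact: h.
    by case: (ord3P k) => ->.
  have ok k : open [set x | 0 < bary t k x].
    apply: (@open_comp _ _ (bary t k) [set y | 0 < y]); last exact: open_gt.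
    by move=> y _; exact: bary_continuous.
  by apply: openI => //; exact: openI.
have : nbhs x (\bigcap_k [set x | 0 < bary t k x]).
  by apply: open_nbhs_nbhs; split => // k _; exact: b0.
apply: filterS => y h; apply/faceP => //; split=> [k|k]; last by rewrite inE.
exact/ltW/h.
Qed.

Lemma triangle_interior_nonempty t : Defs.nondegenerate t -> (triangle t)° !=set0.
Proof.
move=> ndt; exists (\sum_k 3^-1 *: t k).
apply: triangle_interior => // k.
rewrite (bary_unique _ _ (fun=> 3^-1) ndt)//.
by rewrite sum_ord3; field.
Qed.

End Barycentric.

(** * Splitting the domain into triangles *)

Section Triangulation.
Context {R : realType} {m : nat} {Omega : set (R * R)} {N : nat}
  {T : 'I_N -> 'I_3 -> R * R}.
Hypotheses (hOmega : polygonal_lipschitz_domain Omega)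
  (hT : triangulation Omega T).
Implicit Types (x : R * R) (f v w : R * R -> R).

Local Notation plane := (measurableTypeR R * measurableTypeR R)%type.
Local Notation mu := (@leb2 R).
Local Notation cell i := ((triangle (T i))°).

Lemma domain_open : open Omega. Proof. by case: hOmega => -[]. Qed.

Lemma cell_open i : open (cell i). Proof. exact: open_interior. Qed.

Lemma cell_measurable i : measurable (cell i : set plane).
Proof. by apply: open_measurable_plane; exact: cell_open. Qed.

Lemma cell_subset i : cell i `<=` Omega.
Proof.
have [_ [_ lip _]] := hOmega; have [_ cl _] := hT.
apply: lipschitz_closure_interior => //.
- exact: domain_open.
- exact: cell_open.
- by rewrite cl => x /interior_subset Tx; exists i.
Qed.

(** Outside the lines through the edges, a null set, each point of the domain
    has positive barycentric coordinates with respect to exactly one triangle. *)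
Lemma cells_partition_ae : \forall x \ae mu,
  (Omega x -> exists i, cell i x) /\ (forall i j, cell i x -> cell j x -> i = j).
Proof.
have [nd cl int] := hT.
have : \forall x \ae mu, forall i k, bary (T i) k x != 0.
  apply: (@filter_forall _ _ _ _ (leb2_ae_filter)) => i.
  apply: (@filter_forall _ _ _ _ (leb2_ae_filter)) => k.
  exact: bary_ae_neq0.
apply: leb2_aeS => x b0; split.
  move=> Ox; have : closure Omega x by exact: subset_closure.
  rewrite cl => -[i _ Tx]; exists i; apply: triangle_interior => // k.
  have /(faceP _ _ _ (nd i))[+ _] := Tx; move=> /(_ k).
  by rewrite le_eqVlt eq_sym (negbTE (b0 i k)).
move=> i j /interior_subset Ti /interior_subset Tj.
have [//|ij] := eqVneq i j; have [cv cap] := int _ _ ij.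
have : (triangle (T i) `&` triangle (T j)) x by [].
rewrite cap => /(faceP _ _ _ (nd i))[_ h].
have /subsetPn[k _ kS] : ~~ ([set: 'I_3]%SET \subset common_vertices (T i) (T j)).
  by apply: contraNN cv; rewrite finset.subTset.
by have := b0 i k; rewrite (h _ kS) eqxx.
Qed.

Lemma integral_cells f : mu.-integrable Omega (EFin \o f) ->
  \int[mu]_(x in Omega) f x = \sum_i \int[mu]_(x in cell i) f x.
Proof.
move=> intf; have mO := open_measurable_plane _ domain_open.
have intfi i : mu.-integrable setT (EFin \o (f \_ (cell i))).
  rewrite -restrict_EFin; apply/(integrable_mkcond _ (cell_measurable i)).
  apply: integrableS intf => //; first exact: cell_measurable.
  exact: cell_subset.
have intO : mu.-integrable setT (EFin \o (f \_ Omega)).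
  by rewrite -restrict_EFin; apply/(integrable_mkcond _ mO).
rewrite Rintegral_mkcond.
under eq_bigr do rewrite Rintegral_mkcond.
have -> : \sum_i \int[mu]_x (f \_ (cell i)) x = \int[mu]_x (\sum_i (f \_ (cell i)) x).
  rewrite /Rintegral; under [in RHS]eq_integral do rewrite -sumEFin.
  rewrite integral_sum//; apply: sum_fine => i _.
  by apply: integrable_fin_num => //; exact: intfi.
apply: ae_Rintegral => //.
- by have /measurable_EFinP := measurable_int _ intO.
- apply: measurable_sum => i.
  by have /measurable_EFinP := measurable_int _ (intfi i).
apply: leb2_aeS cells_partition_ae => x [ex uniq] _.
rewrite {1}/patch; have [xO|xO] := boolP (x \in Omega).
  have [i xi] := ex (set_mem xO); rewrite (bigD1 i)//= big1 ?addr0.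
    by rewrite /patch mem_set.
  move=> j ji; rewrite /patch; case: ifPn => // /set_mem xj.
  by move: ji; rewrite (uniq _ _ xj xi) eqxx.
rewrite big1// => i _; rewrite /patch; case: ifPn => // /set_mem /cell_subset.
by move=> /mem_set; rewrite (negbTE xO).
Qed.

Lemma cell_Hm i k v : Hm Omega k v -> Hm (cell i) k v.
Proof.
by apply: Hm_subset; [exact: cell_open|exact: domain_open|exact: cell_subset].
Qed.

(** The triangles exhaust the domain up to a null set, and weak derivatives
    restrict to them. *)
Lemma dotD_apw v w : Hm Omega m v -> Hm Omega m w ->
  dotD Omega m v w = apw T m v w.
Proof.
move=> vH wH; have mO := open_measurable_plane _ domain_open.
have wL s f := weak_partial_L2 Omega s f mO.
rewrite dotDE; last exact: domain_open.
transitivity (\sum_(s : m.-tuple 'I_2) \sum_i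
    ip (cell i) (weak_partial Omega s v) (weak_partial Omega s w)).
  by apply: eq_bigr => s _; apply: integral_cells; apply: (L2_mul_integrable mO).
rewrite exchange_big/=; apply: eq_bigr => i _.
rewrite dotDE; last exact: cell_open.
apply: eq_bigr => s _; apply: ae_ip; try exact: cell_measurable.
- by apply: (L2_subset mO (cell_measurable i)) => //; exact: cell_subset.
- by apply: (L2_subset mO (cell_measurable i)) => //; exact: cell_subset.
- by apply: weak_partial_L2; exact: cell_measurable.
- by apply: weak_partial_L2; exact: cell_measurable.
- have := @weak_partial_subset R (cell i) Omega m s v (cell_open i) domain_open
    (cell_subset i).
  rewrite size_tuple => /(_ (leqnn _) vH); apply: leb2_aeS => x + xi.
  by move=> ->.
- have := @weak_partial_subset R (cell i) Omega m s w (cell_open i) domain_open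
    (cell_subset i).
  rewrite size_tuple => /(_ (leqnn _) wH); apply: leb2_aeS => x + xi.
  by move=> ->.
Qed.

End Triangulation.

(** * Broken Sobolev functions and piecewise polynomials *)

Section Polynomials.
Context {R : realType}.
Implicit Types (p f : R * R -> R) (U : set (R * R)).

Local Notation plane := (measurableTypeR R * measurableTypeR R)%type.

Lemma elementaryX f n : elementary f -> elementary (fun x => f x ^+ n).
Proof.
move=> ef; elim: n => [|n ih].
  under eq_fun do rewrite expr0; exact: elementary_cst.
under eq_fun do rewrite exprS; exact: elementaryM.
Qed.

Lemma elementary_sum (I : Type) (r : seq I) (P : pred I) (F : I -> R * R -> R) :
  (forall i, elementary (F i)) ->
  elementary (fun x => \sum_(i <- r | P i) F i x).
Proof.
move=> eF; elim: r => [|i r ih].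
  under eq_fun do rewrite big_nil; exact: elementary_cst.
under eq_fun do rewrite big_cons.
by case: (P i) => //; exact: elementaryD.
Qed.

Lemma polynomial_elementary k p : polynomial_le k p -> elementary p.
Proof.
move=> [c pE]; rewrite (_ : p = fun x => \sum_(i < k.+1) \sum_(j < k.+1 | (i + j <= k)%N)
  c i j * x.1 ^+ i * x.2 ^+ j); last exact/funext.
apply: elementary_sum => i; apply: elementary_sum => j.
apply: elementaryM; last exact/elementaryX/elementary_snd.
by apply: elementaryM; [exact: elementary_cst|exact/elementaryX/elementary_fst].
Qed.

Lemma continuous_L2 U f (M : R) : measurable (U : set plane) ->
  U `<=` square M -> continuous f -> L2 U f.
Proof.
move=> mU UM cf; have [C hC] := continuous_square_bounded M _ cf.
apply: (@bounded_L2 _ _ _ C) => //.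
- apply: le_lt_trans (square_lty M); apply: le_measure; rewrite ?inE//.
  exact: measurable_square.
- by apply: measurable_funTS; exact: continuous_measurable_plane.
- by move=> x /UM; exact: hC.
Qed.

Lemma elementary_partials_L2 U f (M : R) s : open U -> U `<=` square M ->
  elementary f -> L2 U (partials s f).
Proof.
move=> oU UM ef; apply: (continuous_L2 _ _ M) => //.
  exact: open_measurable_plane.
exact/smooth_continuous/smooth_partials/elementary_smooth.
Qed.

Lemma Hm0 U k : open U -> Hm U k (0 : R * R -> R).
Proof.
move=> oU; have mU := open_measurable_plane _ oU.
split=> [|s _]; first exact: L2_0.
exists (cst 0); first exact: L2_0.
have z (h : R * R -> R) : \int[@leb2 R]_(x in U) (0 * h x) = 0.
  by under eq_Rintegral do rewrite mul0r; rewrite /Rintegral integral0.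
by move=> phi _; rewrite [LHS]z [X in _ = _ * X]z mulr0.
Qed.

End Polynomials.

Section PiecewiseSpaces.
Context {R : realType} {m : nat} {Omega : set (R * R)} {N : nat}
  {T : 'I_N -> 'I_3 -> R * R}.
Hypotheses (hOmega : polygonal_lipschitz_domain Omega)
  (hT : triangulation Omega T).
Implicit Types (x : R * R) (f v w : R * R -> R).

Local Notation mu := (@leb2 R).
Local Notation cell i := ((triangle (T i))°).

Lemma domain_bounded : exists M, Omega `<=` square M.
Proof.
have [_ [[M [_ hM]] _ _]] := hOmega; exists (M + 1) => x Ox.
by apply/norm_square; apply: hM => //; rewrite ltrDl.
Qed.

(** The broken Sobolev space, in which conforming and nonconforming functions
    are compared *)
Definition Hm_pw : set (R * R -> R) := [set v | forall i, Hm (cell i) m v].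

Lemma Hm_sub_pw : Hm Omega m `<=` Hm_pw.
Proof. by move=> v vH i; exact: (cell_Hm hOmega hT). Qed.

Lemma Pk_sub_pw k : Pk Omega T k `<=` Hm_pw.
Proof.
move=> v [vL vP] i; have [M OM] := domain_bounded; have [p pk vp] := vP i.
have cO := cell_subset hOmega hT i.
have oc := cell_open i; have mc := cell_measurable i.
have ep := polynomial_elementary _ _ pk.
apply: (Hm_ae _ _ p) => //.
- apply: smooth_Hm; first exact: elementary_smooth.
  by move=> s; apply: (elementary_partials_L2 _ _ M) => //; exact: subset_trans OM.
- apply: L2_subset vL => //; apply: open_measurable_plane.
  exact: (domain_open hOmega).
- by apply: leb2_aeS vp => x + xi => ->.
Qed.

Lemma Hm_pw_subspace : subspace (Hm_pw : set (R * R -> R)).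
Proof.
split=> [i|a v w vH wH i]; last exact: (Hm_linear _ _ _ _ a (cell_open i)).
exact/Hm0/cell_open.
Qed.

Lemma apw_psd : psd_form Hm_pw (apw T m).
Proof.
split=> [v w _ _|a u v w uH vH _|v _].
- by apply: eq_bigr => i _; apply: dotDC; exact: cell_open.
- rewrite /apw mulr_sumr -big_split/=; apply: eq_bigr => i _.
  by apply: (dotD_linear _ m) => //; exact: cell_open.
- by apply: sumr_ge0 => i _; apply: dotD_ge0; exact: cell_open.
Qed.

Lemma apw_cell_ae v v' w : Hm_pw v -> Hm_pw v' ->
  (forall i, v = v' %[ae mu in cell i]) -> apw T m v w = apw T m v' w.
Proof.
move=> vH v'H vv'; apply: eq_bigr => i _; have [vL _] := vH i; have [v'L _] := v'H i.
by apply: dotD_ae => //; exact: cell_open.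
Qed.

Lemma apw_ae v v' w : Hm_pw v -> Hm_pw v' -> v = v' %[ae mu in Omega] ->
  apw T m v w = apw T m v' w.
Proof.
move=> vH v'H vv'; apply: apw_cell_ae => // i; apply: leb2_aeS vv' => x + xi.
by apply; exact: (cell_subset hOmega hT i).
Qed.

(** A piecewise polynomial is determined by its coefficients on the triangles,
    so that the size of an orthonormal family is at most their number. *)
Lemma orthonormal_bound k (A : set (R * R -> R)) n (e : 'I_n -> R * R -> R) :
  A `<=` Pk Omega T k -> (forall i, A (e i)) ->
  (forall i j, apw T m (e i) (e j) = (i == j)%:R) ->
  (n <= #|{: 'I_N * ('I_k.+1 * 'I_k.+1)}|)%N.
Proof.
move=> AP Ae oe; rewrite leqNgt; apply/negP => nM.
have /choice[c hc] : forall z : 'I_n * 'I_N, exists c : nat -> nat -> R,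
    e z.1 = (fun x => \sum_(i < k.+1) \sum_(j < k.+1 | (i + j <= k)%N)
            c i j * x.1 ^+ i * x.2 ^+ j) %[ae mu in cell z.2].
  move=> [l i]; have [_ /(_ i)[p [c pE] ep]] := AP _ (Ae l); exists c.
  by apply: leb2_aeS ep => x + xi => /= ->.
pose B := \matrix_(l < n, q < #|{: 'I_N * ('I_k.+1 * 'I_k.+1)}|)
  c (l, (enum_val q).1) (enum_val q).2.1 (enum_val q).2.2.
have /rowV0Pn[y /sub_kermxP yB y0] : kermx B != 0.
  rewrite -mxrank_eq0 mxrank_ker subn_eq0 -ltnNge.
  exact: leq_ltn_trans (rank_leq_col B) nM.
have We l : Hm_pw (e l) by exact/(Pk_sub_pw k)/AP.
have W0 := subspace0 Hm_pw_subspace.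
pose v : R * R -> R := \sum_l y ord0 l *: e l.
have Wv : Hm_pw v by exact: (subspace_sum Hm_pw_subspace).
have v0 i : v = 0 %[ae mu in cell i].
  have : \forall x \ae mu, forall l : 'I_n, cell i x ->
      e l x = \sum_(a < k.+1) \sum_(b < k.+1 | (a + b <= k)%N)
            c (l, i) a b * x.1 ^+ a * x.2 ^+ b.
    by apply: (@filter_forall _ _ _ _ leb2_ae_filter) => l; exact: (hc (l, i)).
  apply: leb2_aeS => x ex xi.
  have -> : v x = \sum_l y ord0 l * e l x.
    by rewrite /v fct_sumE.
  under eq_bigr => l _ do rewrite ex// mulr_sumr.
  rewrite exchange_big big1// => a _.
  under eq_bigr => l _ do rewrite mulr_sumr.
  rewrite exchange_big big1// => b _.
  have yc : \sum_l y ord0 l * c (l, i) a b = 0.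
    have := congr1 (fun D : 'rV_ _ => D ord0 (enum_rank (i, (a, b)))) yB.
    rewrite [RHS]mxE mxE => h; rewrite -[RHS]h; apply: eq_bigr => l _.
    by rewrite mxE enum_rankK.
  by under eq_bigr => l _ do rewrite !mulrA; rewrite -!mulr_suml yc !mul0r.
have [l yl] : exists l, y ord0 l != 0.
  by apply/existsP; apply: contraNT y0; rewrite negb_exists => /forallP y0;
    apply/eqP/rowP => l; rewrite mxE; apply/eqP/negPn; exact: y0.
move/eqP: yl; apply.
have := apw_cell_ae v 0 (e l) Wv W0 v0.
rewrite (form0l Hm_pw_subspace apw_psd)// (form_suml Hm_pw_subspace apw_psd)//.
rewrite (bigD1 l)//= oe eqxx mulr1 big1 ?addr0// => j jl.
by rewrite oe (negbTE jl) mulr0.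
Qed.

End PiecewiseSpaces.

(** * Derivatives of polynomials along lines *)

Section NonPolynomial.
Context {R : realType}.
Implicit Types (x : R * R) (f g v w phi : R * R -> R) (U : set (R * R)).

Local Notation plane := (measurableTypeR R * measurableTypeR R)%type.
Local Notation mu := (@leb2 R).

Lemma ip_eq0 U f : measurable (U : set plane) -> L2 U f -> ip U f f = 0 ->
  f = cst 0 %[ae mu in U].
Proof.
move=> mU fL f0; have intf := L2_mul_integrable mU fL fL.
have mf := measurable_int _ intf.
have : (\int[mu]_(x in U) `|(f x * f x)%:E| = 0)%E.
  rewrite -[RHS](congr1 EFin f0) /ip /Rintegral fineK.
    by apply: eq_integral => x _; rewrite gee0_abs// lee_fin -expr2 sqr_ge0.
  exact: integrable_fin_num.
move/(ae_eq_integral_abs _ mU mf); apply: leb2_aeS => x + Ux => /(_ Ux) /= [] /eqP.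
by rewrite mulf_eq0 orbb => /eqP.
Qed.

(** Otherwise the open set where they differ would contain a rectangle of positive
    measure. *)
Lemma continuous_ae_eq U f g : open U -> continuous f -> continuous g ->
  f = g %[ae mu in U] -> forall x, U x -> f x = g x.
Proof.
move=> oU cf cg fg x Ux; apply: contrapT => /eqP fgx.
have oA : open (U `&` [set y | f y - g y != 0]).
  apply: openI => //.
  apply: (@open_comp _ _ (fun y => f y - g y) [set t | t != 0]); last exact: open_neq.
  by move=> y _; apply: cvgB; [exact: cf|exact: cg].
have [a [b [c [d [sub cov]]]]] := open_rectangle_cover _ oA.
have [n _ rx] : (\bigcup_n rect (a n) (b n) (c n) (d n)) x.
  by apply: cov; split; rewrite //= subr_eq0.
have nr : mu.-negligible (rect (a n) (b n) (c n) (d n)).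
  apply: negligibleS fg => y /rect_subset /sub[Uy /= fgy] /(_ Uy) fgE.
  by move: fgy; rewrite fgE subrr eqxx.
have := measure_negligible (measurable_rect _ _ _ _) nr.
have [/= h1 h2] := rx; move: h1 h2; rewrite !in_itv/= => /andP[h1 h2] /andP[h3 h4].
have h5 := lt_trans h1 h2; have h6 := lt_trans h3 h4.
rewrite leb2_rectangle//= !lebesgue_measure_itv/= !lte_fin h5 h6 -!EFinD -EFinM.
by move=> [] /eqP; rewrite gt_eqF// mulr_gt0// subr_gt0.
Qed.

Lemma derive_horner_fst (P : R -> {poly R}) x :
  'D_(unit_vec 0) (fun x => (P x.2).[x.1]) x = ((P x.2)^`()).[x.1].
Proof.
case: x => a b; have [_ <-] := is_derive_poly (P b) a.
have E : (fun h : R => h^-1 *: ((fun x => (P x.2).[x.1]) (h *: (1, 0) + (a, b))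
    - (P b).[a])) = (fun h : R => h^-1 *: ((P b).[h *: 1 + a] - (P b).[a])).
  by apply/funext => h; rewrite /= scaler0 add0r.
by rewrite unit_vec0 /derive E.
Qed.

Lemma partials_horner_fst k (P : R -> {poly R}) :
  partials (nseq k 0) (fun x => (P x.2).[x.1]) = fun x => ((P x.2)^`(k)).[x.1].
Proof.
elim: k => [//|k ih] /=; rewrite ih; apply/funext => x.
by rewrite (derive_horner_fst (fun y => (P y)^`(k))).
Qed.

(** Along a horizontal line, a polynomial of degree at most [k] is a univariate
    polynomial of degree at most [k]. *)
Lemma polynomial_partials k p : polynomial_le k p ->
  exists C : R -> R, forall x, partials (nseq k 0) p x = C x.2.
Proof.
move=> [c pE].
pose P (y : R) : {poly R} :=
  \poly_(i < k.+1) (\sum_(j < k.+1 | (i + j <= k)%N) c i j * y ^+ j).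
have -> : p = fun x => (P x.2).[x.1].
  apply/funext => x; rewrite pE horner_poly; apply: eq_bigr => i _.
  by rewrite mulr_suml; apply: eq_bigr => j _; rewrite mulrAC.
exists (fun y => ((P y)^`(k))`_0) => x; rewrite partials_horner_fst.
have sz : (size (P x.2)^`(k) <= 1)%N.
  apply/leq_sizeP => j j0; rewrite coef_derivn nth_default ?mul0rn//.
  by apply: leq_trans (size_poly _ _) _; rewrite -addn1 leq_add2l.
by rewrite [X in X.[_]](size1_polyC sz) hornerC.
Qed.

(** A function with compact support is recovered from its derivative by
    integration along lines. *)
Lemma partials_fst_eq0 k phi (M : R) : smooth phi ->
  (forall s x, M < `|x| -> partials s phi x = 0) ->
  (forall x, partials (nseq k 0) phi x = 0) -> forall x, phi x = 0.
Proof.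
move=> sp p0; elim: k => [//|k ih] /= Dk0; apply: ih => -[a b].
have sk := smooth_partials _ (nseq k 0) sp.
pose N : R := `|M| + 1.
have -> : partials (nseq k 0) phi (a, b) = partials (nseq k 0) phi (N, b).
  apply: (@is_derive_0_is_cst R (fun t => partials (nseq k 0) phi (t, b))) => t.
  by rewrite -(Dk0 (t, b)); apply: derive_fst; exact: smooth_derivable.
apply: p0; rewrite prod_normE lt_max/= ger0_norm ?addr_ge0//.
by rewrite (le_lt_trans (ler_norm M))// ltrDl.
Qed.

End NonPolynomial.

(** * A conforming function off the piecewise polynomials *)

Section Conforming.
Context {R : realType}.
Implicit Types (x : R * R) (f g v w phi : R * R -> R) (U : set (R * R)).

Local Notation mu := (@leb2 R).

Lemma dotD0 U k w : open U -> dotD U k 0 w = 0.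
Proof.
move=> oU; have H0 := Hm0 U k oU.
have := dotD_linear U k k 0 0 w 1 oU (leqnn k) H0 H0.
rewrite (_ : (fun x => 1 * (0 : R * R -> R) x + (0 : R * R -> R) x) = 0); last first.
  by apply/funext => x; rewrite mulr0 addr0.
lra.
Qed.

Lemma test_H0m U m phi : open U -> test_function U phi -> H0m U m phi.
Proof.
move=> oU tphi; split; first exact: test_Hm.
move=> eps e0; exists phi => //.
rewrite (_ : phi \- phi = 0); last by apply/funext => x; exact: subrr.
by rewrite /Hm_norm big1 ?sqrtr0// => k _; exact: dotD0.
Qed.

Lemma H0m0 U m : open U -> H0m U m 0.
Proof.
move=> oU; apply: test_H0m => //.
rewrite /test_function (_ : [set x | _] = set0); last first.
  by apply/seteqP; split=> x //=; rewrite eqxx.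
rewrite closure0; split => //; last exact: compact0.
exact/elementary_smooth/elementary_cst.
Qed.

(** Cauchy-Schwarz for the energy product, one of the terms of the full norm *)
Lemma dotD_bounded U m u v : open U -> Hm U m u -> Hm U m v ->
  `|dotD U m u v| <= Num.sqrt (dotD U m u u) * Hm_norm U m v.
Proof.
move=> oU uH vH.
have hs : subspace (Hm U m : set (R * R -> R)).
  by split=> [|a f g fH gH]; [exact: Hm0|exact: Hm_linear].
have hf : psd_form (Hm U m) (dotD U m).
  split=> [f g _ _|a f g h fH gH _|f _].
  - exact: dotDC.
  - exact: (dotD_linear U m m).
  - exact: dotD_ge0.
have cs := form_CS hs hf uH vH.
have sm : dotD U m v v <= \sum_(k < m.+1) dotD U k v v.
  rewrite big_ord_recr/= lerDr; apply: sumr_ge0 => k _; exact: dotD_ge0.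
rewrite /Hm_norm -sqrtrM; last exact: dotD_ge0.
rewrite -sqrtr_sqr ler_sqrt; last first.
  rewrite mulr_ge0// ?dotD_ge0//; apply: le_trans sm; exact: dotD_ge0.
by apply: le_trans cs _; rewrite ler_wpM2l// dotD_ge0.
Qed.

Section Cells.
Context {m : nat} {Omega : set (R * R)} {N : nat} {T : 'I_N -> 'I_3 -> R * R}.
Hypotheses (hOmega : polygonal_lipschitz_domain Omega)
  (hT : triangulation Omega T).
Local Notation cell i := ((triangle (T i))°).

(** On a triangle, the [m]-th derivative of a bump in the first variable would
    have to agree with that of a polynomial of degree [m], which is constant
    along horizontal lines; it vanishes near the boundary of the triangle, so it
    would vanish identically, and so would the bump. *)
Lemma conforming_not_polynomial : exists u, H0m Omega m u /\
  forall w, Pk Omega T m w -> apw T m (u - w) (u - w) != 0.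
Proof.
have [nd cl _] := hT; have oO := domain_open hOmega.
have [i0] : exists i0 : 'I_N, True.
  have [[_ _ [x Ox]] _] := hOmega.
  by have : closure Omega x by [exact: subset_closure]; rewrite cl => -[i _ _]; exists i.
move=> _; have oc := cell_open (T := T) i0; have mc := cell_measurable (T := T) i0.
have [x0 cx0] := triangle_interior_nonempty _ (nd i0).
have [a' [b' [c' [d' [sub cov]]]]] := open_rectangle_cover _ oc.
have [n _ rx0] := cov _ cx0.
move: (a' n) (b' n) (c' n) (d' n) (sub n) rx0 => a b c d {}sub rx0.
pose phi := bump a b c d 0.
have tphi : test_function (cell i0) phi by exact: bump_test.
have cO := cell_subset hOmega hT i0.
exists phi; split; first by apply: test_H0m => //; exact: test_function_subset tphi cO.
move=> w wP; apply/eqP => ww0.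
have Wphi : Hm_pw (m := m) (T := T) phi.
  apply: (Hm_sub_pw hOmega hT); apply: test_Hm => //.
  exact: test_function_subset tphi cO.
have Ww : Hm_pw (m := m) (T := T) w := Pk_sub_pw hOmega hT m _ wP.
have sphi : smooth phi by case: tphi.
(* the energy on the triangle vanishes, hence so does each derivative there *)
have dd0 : dotD (cell i0) m (phi - w) (phi - w) = 0.
  move: ww0; rewrite /apw => /eqP; rewrite psumr_eq0; last first.
    by move=> i _; apply: dotD_ge0; exact: cell_open.
  by move=> /allP /(_ i0); rewrite mem_index_enum => /(_ isT) /eqP.
pose s0 : m.-tuple 'I_2 := nseq_tuple m 0.
have wp0 : weak_partial (cell i0) s0 (phi - w) = cst 0 %[ae mu in cell i0].
  apply: ip_eq0 => //; first exact: weak_partial_L2.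
  move: dd0; rewrite dotDE// => /eqP; rewrite psumr_eq0; last by move=> s _; exact: ip_ge0.
  by move=> /allP /(_ s0); rewrite mem_index_enum => /(_ isT) /eqP.
have [p pk wp] := wP.2 i0.
have sp : smooth p by exact/elementary_smooth/(polynomial_elementary m).
have [M OM] := domain_bounded hOmega.
have cM : cell i0 `<=` square M by exact: subset_trans cO OM.
have pL s : L2 (cell i0) (partials s p).
  by apply: (elementary_partials_L2 _ _ M) => //; exact: (polynomial_elementary m).
have wL : L2 (cell i0) w by case: (Ww i0).
have Dphi : weak_partial (cell i0) s0 phi = partials s0 phi %[ae mu in cell i0].
  have := smooth_weak_partialE (cell i0) s0 phi oc sphi (fun s => test_L2 _ _ s mc tphi).
  by rewrite /= rev_nseq.
have Dw : weak_partial (cell i0) s0 w = partials s0 p %[ae mu in cell i0].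
  rewrite (weak_partial_ae _ s0 w p mc wL (pL [::]) wp).
  have := smooth_weak_partialE (cell i0) s0 p oc sp pL.
  by rewrite /= rev_nseq.
have Dlin := weak_partial_linear (cell i0) m s0 w phi (- 1) oc.
have {Dlin} Dlin : weak_partial (cell i0) s0 (phi - w) =
    (fun x => - 1 * weak_partial (cell i0) s0 w x + weak_partial (cell i0) s0 phi x)
    %[ae mu in cell i0].
  have E : phi - w = (fun x => - 1 * w x + phi x).
    by apply/funext => x; rewrite mulN1r addrC.
  by rewrite E; apply: Dlin; rewrite ?size_tuple.
have DE : partials s0 phi = partials s0 p %[ae mu in cell i0].
  have h1 := @filterI _ _ leb2_ae_filter _ _ Dphi Dw.
  have h2 := @filterI _ _ leb2_ae_filter _ _ Dlin wp0.
  apply: leb2_aeS2 h1 h2 => x [e1 e2] [e3 e4] cx.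
  move: (e1 cx) (e2 cx) (e3 cx) (e4 cx) => {e1 e2 e3 e4} e1 e2 -> /=.
  rewrite e1 e2 => /eqP; rewrite mulN1r addrC subr_eq0.
  by move=> /eqP.
have {}DE := continuous_ae_eq _ _ _ oc (smooth_continuous _ (smooth_partials _ s0 sphi))
  (smooth_continuous _ (smooth_partials _ s0 sp)) DE.
have [C hC] := polynomial_partials _ _ pk.
have out0 s x : ~ crect a b c d x -> partials s phi x = 0.
  elim: s x => [|i s ih] x nx /=.
    apply/eqP; apply: contra_notT nx => /bump_neq0; exact: rect_subset.
  apply: (derive_vanish _ _ _ _ ih) => //.
  apply: compact_closed; first exact: norm_hausdorff.
  by apply: compact_setX; exact: segment_compact.
(* just beyond the right side of the rectangle, still in the triangle *)
have C0 y : `[c, d]%classic y -> C y = 0.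
  move=> cdy; have ab : a <= b.
    by move: rx0 => [/= + _]; rewrite in_itv/= => /andP[h1 h2]; exact/ltW/(lt_trans h1).
  have cb : cell i0 (b, y) by apply: sub; split => //=; rewrite in_itv/= ab lexx.
  have /nbhs_ballP[e /= e0 eb] : nbhs (b, y) (cell i0) by exact: open_nbhs_nbhs.
  have e2 : 0 < e / 2 by rewrite divr_gt0.
  have cbe : cell i0 (b + e / 2, y).
    apply: eb; split; rewrite /ball/=; last by rewrite subrr normr0.
    rewrite opprD addNKr normrN gtr0_norm//.
    by rewrite gtr_pMr// invf_lt1// ltr1n.
  rewrite -(hC (b + e / 2, y)) -DE// out0// => -[/=].
  by rewrite in_itv/= => /andP[_]; rewrite gerDl leNgt e2.
have [K [_ _ [L KL] K0]] := test_function_support tphi.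
have : phi x0 = 0.
  apply: (partials_fst_eq0 m phi L sphi) => [s x Lx|x].
    by apply: K0 => /KL /norm_square; rewrite leNgt Lx.
  have [xr|xr] := pselect (crect a b c d x); last exact: out0.
  by have := DE _ (sub _ xr); rewrite hC C0//; case: xr.
by apply/eqP/bump_neq0.
Qed.

End Cells.
End Conforming.

(** * The modified nonconforming scheme *)

Lemma sqrt_le_scale {R : rcfType} (l x y : R) : 0 <= x -> 0 <= y ->
  Num.sqrt x <= l * Num.sqrt y -> x <= l ^+ 2 * y.
Proof.
move=> x0 y0 h; rewrite -(sqr_sqrtr x0) -(sqr_sqrtr y0) -exprMn.
by rewrite ler_sqr ?nnegrE ?sqrtr_ge0//; apply: le_trans h; exact: sqrtr_ge0.
Qed.

Lemma sqrt_ratio_le {R : rcfType} (x y z : R) : 0 < y -> 0 <= z -> x <= z * y ->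
  Num.sqrt x / Num.sqrt y <= Num.sqrt z.
Proof.
move=> y0 z0 h; rewrite ler_pdivrMr ?sqrtr_gt0// -sqrtrM//.
by rewrite ler_sqrt// mulr_ge0// ltW.
Qed.

Section Setting.
Context {R : realType} {m : nat} {Omega : set (R * R)} {N : nat}
  {T : 'I_N -> 'I_3 -> R * R} {Vnc : set (R * R -> R)}
  {Inc : (R * R -> R) -> R * R -> R} {kappa : R}
  {J : (R * R -> R) -> R * R -> R} {LambdaJ : R}.
Hypotheses (hOmega : polygonal_lipschitz_domain Omega)
  (hT : triangulation Omega T) (hVnc : nc_space m Omega T Vnc)
  (hInc : interpolation m Omega T Vnc Inc kappa)
  (hJ : companion m Omega T Vnc Inc J LambdaJ).

Local Notation mu := (@leb2 R).
Local Notation W := (@Hm_pw R m N T).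
Local Notation b := (apw T m).
Local Notation V := (H0m Omega m).

Let hW := @Hm_pw_subspace R m N T.
Let hb := @apw_psd R m N T.

Lemma Vnc_subspace : subspace Vnc.
Proof. by have [_ [h0 hl _] _ _] := hVnc; split => //; exact: hl. Qed.

Lemma H0m_sub_pw : V `<=` W.
Proof. by move=> v [vH _]; exact: (Hm_sub_pw hOmega hT). Qed.

Lemma Vnc_sub_pw : Vnc `<=` W.
Proof. by have [h _ _ _] := hVnc; move=> v /h; exact: (Pk_sub_pw hOmega hT). Qed.

Lemma Inc_Vnc v : V v -> Vnc (Inc v).
Proof. by have [[h _] _ _] := hInc; exact: h. Qed.

Lemma Inc_orth v w : V v -> Vnc w -> b (v - Inc v) w = 0.
Proof.
have [h _ _ _] := hVnc; have [_ io _] := hInc.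
by move=> Vv /h wP; exact: io.
Qed.

Lemma J_H0m v : Vnc v -> V (J v).
Proof. by have [[[h _] _] _ _] := hJ; exact: h. Qed.

Lemma null_pw v : W v -> v = 0 %[ae mu in Omega] -> b v v = 0.
Proof.
move=> Wv v0; rewrite (apw_ae hOmega hT v 0 v)//; last exact: subspace0.
exact: (form0l hW hb).
Qed.

Lemma J_linear (a : R) v w : Vnc v -> Vnc w ->
  let r := J (a *: v + w) - (a *: J v + J w) in b r r = 0.
Proof.
move=> Av Aw; have [[_ lin] _ _] := hJ; apply: null_pw.
  have Avw : Vnc (a *: v + w) by case: Vnc_subspace => _; apply.
  apply: (subspaceB hW); first exact/H0m_sub_pw/J_H0m.
  by case: hW => _; apply; exact/H0m_sub_pw/J_H0m.
have := lin a _ _ Av Aw; apply: leb2_aeS => x + Ox => /(_ Ox) E.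
by apply/eqP; rewrite subr_eq0; apply/eqP.
Qed.

(** Since [v] represents the interpolation of [J v], the correction [J v - v] is an
    interpolation error. *)
Lemma J_orth v w : Vnc v -> Vnc w -> b (J v - v) w = 0.
Proof.
move=> Av Aw; have VJ := J_H0m _ Av; rewrite -[RHS](Inc_orth (J v) w VJ Aw).
have WJ := H0m_sub_pw _ VJ.
apply: (apw_ae hOmega hT).
- by apply: (subspaceB hW) => //; exact: Vnc_sub_pw.
- by apply: (subspaceB hW) => //; exact/Vnc_sub_pw/Inc_Vnc.
have [_ IJ _] := hJ; have := IJ _ Av; apply: leb2_aeS => x + Ox => /(_ Ox) E.
by rewrite (_ : (J v - v) x = J v x - v x)// -E.
Qed.

Lemma normpw_eq0 v : Vnc v -> b v v = 0 -> v = 0 %[ae mu in Omega].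
Proof.
by have [_ _ _ [_ h _ _]] := hVnc; move=> Av v0; apply: h => //;
  rewrite /normpw v0 sqrtr0.
Qed.

Lemma normpwB v w : normpw T m (v \- w) = Num.sqrt (b (v - w) (v - w)).
Proof. by have <- : v \- w = v - w by []. Qed.

Lemma normpw_defect v : normpw T m (v \- J v) = Num.sqrt (defect b J v v).
Proof. exact: normpwB. Qed.

(** The quotient is bounded, by stability of [J] tested with [v = 0], and the
    discrete space is finite-dimensional, so a maximiser exists; its normalisation
    makes the maximal value of the defect the square of the constant. *)
Lemma Lambda0_attained : let L := Lambda0 m Omega T Vnc J in
  exists e, [/\ 0 <= L, Vnc e, b e e = 1, defect b J e e = L ^+ 2 &
    forall v, Vnc v -> defect b J v v <= L ^+ 2 * b v v].
Proof.
move=> L; have dpsd : psd_form Vnc (defect b J).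
  exact: (defect_psd hW hb V Vnc J Vnc_subspace H0m_sub_pw Vnc_sub_pw J_H0m J_linear).
have bound v : Vnc v -> defect b J v v <= LambdaJ ^+ 2 * b v v.
  move=> Av; have [_ _ stab] := hJ.
  have := stab v 0 Av (H0m0 _ _ (domain_open hOmega)); rewrite normpw_defect.
  rewrite (_ : v \- 0 = v); last by apply/funext => x; exact: subr0.
  have g0 := form_ge0 dpsd Av; have v0 := form_ge0 hb (Vnc_sub_pw _ Av).
  exact: (sqrt_le_scale _ _ _ g0 v0).
have [_ _ [v0 Av0 v0n] _] := hVnc.
have nz : exists2 v, Vnc v & b v v != 0.
  by exists v0 => //; apply/eqP => /(normpw_eq0 _ Av0).
have [VP _ _ _] := hVnc.
have [e [Ae ee emax]] := form_maximiser hW hb Vnc (defect b J) _ _ Vnc_subspace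
  Vnc_sub_pw dpsd bound (fun n f => orthonormal_bound hOmega hT m Vnc n f VP) nz.
have g0 := form_ge0 dpsd Ae.
pose S := [set normpw T m (v \- J v) / normpw T m v |
  v in [set v | Vnc v /\ ~ v = cst 0 %[ae mu in Omega]]].
have eS : S (Num.sqrt (defect b J e e)).
  exists e; last by rewrite normpw_defect /normpw ee sqrtr1 divr1.
  split=> // e0; have := null_pw e (Vnc_sub_pw _ Ae) e0.
  by rewrite ee => /eqP; rewrite oner_eq0.
have Sle : ubound S (Num.sqrt (defect b J e e)).
  move=> _ [v [Av vn] <-]; rewrite normpw_defect /normpw.
  have vpos : 0 < b v v.
    rewrite lt_neqAle (form_ge0 hb (Vnc_sub_pw _ Av)) andbT eq_sym.
    by apply/eqP => /(normpw_eq0 _ Av).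
  exact: (sqrt_ratio_le _ _ _ vpos g0 (emax _ Av)).
have LE : L = Num.sqrt (defect b J e e).
  apply/eqP; rewrite eq_le; apply/andP; split.
    by apply: ge_sup => //; exists (Num.sqrt (defect b J e e)).
  by apply: ub_le_sup => //; exists (Num.sqrt (defect b J e e)).
by exists e; rewrite LE sqrtr_ge0 sqr_sqrtr//; split.
Qed.

(** The energy product on the domain is the piecewise one for conforming
    functions, so that [F (J v)] is [apw T m u (J v)]. *)
Lemma nc_solution_scheme F u w : solution m Omega F u ->
  nc_solution m T Vnc J F w <-> scheme b Vnc J u w.
Proof.
move=> [Vu uF]; have key v : Vnc v -> F (J v) = b u (J v).
  move=> Av; have VJ := J_H0m _ Av; rewrite -uF//.
  by apply: (dotD_apw hOmega hT); [case: Vu|case: VJ].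
split=> -[Aw h]; (split; first exact: Aw) => v Av.
  by rewrite -(key _ Av); exact: h.
by rewrite (key _ Av); exact: h.
Qed.

End Setting.

Theorem theorem3p2 (R : realType) (m : nat) (hm : (0 < m)%N)
  (Omega : set (R * R)) (hOmega : polygonal_lipschitz_domain Omega)
  (N : nat) (T : 'I_N -> 'I_3 -> R * R) (hT : triangulation Omega T)
  (sigma : R) (hsigma : shape_regular sigma T)
  (Vnc : set (R * R -> R)) (hVnc : nc_space m Omega T Vnc)
  (Inc : (R * R -> R) -> R * R -> R) (kappa : R) (hkappa : 0 < kappa)
  (hInc : interpolation m Omega T Vnc Inc kappa)
  (J : (R * R -> R) -> R * R -> R) (LambdaJ : R)
  (hJ : companion m Omega T Vnc Inc J LambdaJ) :
  let Cqo := Num.sqrt (1 + Lambda0 m Omega T Vnc J ^+ 2) in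
  (forall (F : (R * R -> R) -> R) (u unc : R * R -> R),
     H0m_dual Omega m F ->
     solution m Omega F u ->
     nc_solution m T Vnc J F unc ->
     normpw T m (u \- unc) <= Cqo * normpw T m (u \- Inc u))
  /\
  (exists (u : R * R -> R) (F : (R * R -> R) -> R),
     [/\ H0m_dual Omega m F, solution m Omega F u,
         exists unc, nc_solution m T Vnc J F unc &
         forall unc, nc_solution m T Vnc J F unc ->
           normpw T m (u \- unc) = Cqo * normpw T m (u \- Inc u) /\
           0 < Cqo * normpw T m (u \- Inc u)]).
Proof.
move=> Cqo; set L := Lambda0 m Omega T Vnc J in Cqo *.
have hW := @Hm_pw_subspace R m N T; have hb := @apw_psd R m N T.
have VW := H0m_sub_pw hOmega hT; have AW := Vnc_sub_pw hOmega hT hVnc.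
have hA := Vnc_subspace hVnc; have IV := Inc_Vnc hInc; have JA := J_H0m hJ.
have Iorth := Inc_orth hVnc hInc; have Jlin := J_linear hOmega hT hVnc hJ.
have Jorth := J_orth hOmega hT hVnc hInc hJ.
have [e [L0 Ae ee eL eM]] := Lambda0_attained hOmega hT hVnc hJ.
have sqC (y : R) : Num.sqrt ((1 + L ^+ 2) * y) = Cqo * Num.sqrt y.
  by rewrite sqrtrM// addr_ge0// sqr_ge0.
split=> [F u unc _ uF uncF|].
  have Vu := uF.1; move/(nc_solution_scheme hOmega hT hJ F u unc uF) : uncF => sch.
  rewrite !normpwB -sqC ler_sqrt; last first.
    by rewrite mulr_ge0// ?addr_ge0 ?sqr_ge0// (form_ge0 hb)//;
      apply: (subspaceB hW); [exact: VW|exact/AW/IV].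
  exact: (quasi_optimal hW hb (H0m Omega m) Vnc Inc J).
have [u [Vu [w uw] upos uE]] : exists u, [/\ H0m Omega m u,
    exists w, scheme (apw T m) Vnc J u w, 0 < apw T m (u - Inc u) (u - Inc u) &
    forall w, scheme (apw T m) Vnc J u w ->
      apw T m (u - w) (u - w) = (1 + L ^+ 2) * apw T m (u - Inc u) (u - Inc u)].
  apply: (quasi_optimal_sharp hW hb (H0m Omega m) Vnc Inc J _ _ _ _ _ _ _ _ L e) => //.
  have [u [Vu un]] := @conforming_not_polynomial R m Omega N T hOmega hT.
  have [VP _ _ _] := hVnc; exists u; first exact: Vu.
  by apply: un; apply: VP; exact: IV.
have oO := domain_open hOmega; have uH := Vu.1.
pose F v := dotD Omega m u v.
have uF : solution m Omega F u by [].
exists u, F; split.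
- split=> [a v w' [vH _] [wH _]|].
    rewrite /F (dotDC _ _ u _ oO) (dotD_linear _ m _ _ _ _ _ oO (leqnn m) vH wH).
    by rewrite (dotDC _ _ v _ oO) (dotDC _ _ w' _ oO).
  by exists (Num.sqrt (dotD Omega m u u)) => v [vH _]; exact: dotD_bounded.
- exact: uF.
- by exists w; exact/(nc_solution_scheme hOmega hT hJ F u w uF).
- move=> unc /(nc_solution_scheme hOmega hT hJ F u unc uF) sch; rewrite !normpwB -sqC.
  split; first by rewrite (uE _ sch).
  by rewrite sqrtr_gt0 mulr_gt0// ltr_pwDl// sqr_ge0.
Qed.
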